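(* Let $1<p<\infty$ and let $C_1$ be the finite continuous Cesàro operator on the complex Banach space $L^p[0,1]$, $(C_1f)(x)=\frac1x\int_0^x f(t)\,dt$. If $\lambda\in\mathbb C$ is an extended eigenvalue for $C_1$ on $L^p[0,1]$, then $\lambda$ is real and $0<\lambda\le 1$.
   Context: A complex scalar $\lambda$ is an extended eigenvalue of a bounded linear operator $T$ on a complex Banach space $E$ if there is a nonzero bounded linear operator $X$ on $E$ with $TX=\lambda XT$. It is a known fact that $C_1$ is bounded on $L^p[0,1]$ for $1<p<\infty$. *)

(* Defs.v *)
From HB Require Import structures.
From mathcomp Require Import all_boot all_order all_algebra.
From mathcomp Require Import complex.
From mathcomp Require Import all_classical all_reals all_analysis.
From mathcomp Require Import measurable_realfun.

Set Implicit Arguments.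
Unset Strict Implicit.
Unset Printing Implicit Defensive.
Import Order.TTheory GRing.Theory Num.Theory.
Import numFieldNormedType.Exports.

Local Open Scope classical_set_scope.
Local Open Scope ring_scope.
Local Open Scope complex_scope.
Local Open Scope quotient_scope.

Section cLfun.
Context d (T : measurableType d) (R : realType).
Variables (mu : {measure set T -> \bar R}) (D : set T) (p : R).
Local Notation Re := (@complex.Re R).
Local Notation Im := (@complex.Im R).

(* The modulus of f, set to 0 outside D: its L^p norm on the whole of T is
   (\int_D |f|^p)^(1/p). *)
Definition cmod (f : T -> R[i]) : T -> R := (@Normc.normc R \o f) \_ D.

(* R[i] carries no sigma-algebra in the library; a complex function is
   measurable when its real and imaginary parts are. *)
Definition cLfun : {pred T -> R[i]} := [pred f : T -> R[i] |
  `[< [/\ measurable_fun D (Re \o f), measurable_fun D (Im \o f) &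
          finite_norm mu p%:E (cmod f)] >]].

Lemma cLfunP f : reflect
  [/\ measurable_fun D (Re \o f), measurable_fun D (Im \o f) &
      finite_norm mu p%:E (cmod f)] (f \in cLfun).
Proof. exact: asboolP. Qed.

Lemma cmod_ge0 f x : 0 <= cmod f x.
Proof.
by rewrite /cmod patchE; case: ifP => //= _; case: (f x) => a b; exact: sqrtr_ge0.
Qed.

Lemma cmodD f g x : cmod (f + g) x <= cmod f x + cmod g x.
Proof.
rewrite /cmod !patchE; case: ifP => /= _; last by rewrite addr0.
by have := ler_normD (f x) (g x); rewrite /Num.norm/= -rmorphD/= lecR.
Qed.

Lemma cmodZ a f : cmod (a *: f) = Normc.normc a \*: cmod f.
Proof.
apply/funext => x; rewrite /cmod /= !patchE.
by case: ifP => /= _; rewrite ?scaler0// Normc.normcM.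
Qed.

Hypotheses (mD : measurable D) (p1 : 1 <= p).

Lemma measurable_cmod f :
  measurable_fun D (Re \o f) -> measurable_fun D (Im \o f) ->
  measurable_fun setT (cmod f).
Proof.
move=> mr mi; apply/(measurable_restrictT _ mD).
rewrite (_ : _ \o f = Num.sqrt \o
   (fun x => Re (f x) ^+ 2 + Im (f x) ^+ 2)); last first.
  by apply/funext => x /=; case: (f x).
apply: measurableT_comp; last first.
  by apply: measurable_funD; exact: measurable_funX.
by apply: continuous_measurable_fun; exact: sqrt_continuous.
Qed.

Let p1E : (1 <= p%:E)%E. Proof. by rewrite lee_fin. Qed.
Let p0 : 0 < p. Proof. exact: lt_le_trans p1. Qed.

Lemma le_Lnorm (f g : T -> R) :
  measurable_fun setT f -> measurable_fun setT g ->
  (forall x, 0 <= f x <= g x) ->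
  ('N[mu]_p%:E[EFin \o f] <= 'N[mu]_p%:E[EFin \o g])%E.
Proof.
move=> mf mg fg; rewrite unlock /Lnorm.
apply: gt0_ler_poweR; rewrite ?invr_ge0 ?(ltW p0)// ?in_itv/= ?andbT ?leey//.
- by rewrite integral_ge0// => x _; exact: poweR_ge0.
- by rewrite integral_ge0// => x _; exact: poweR_ge0.
apply: ge0_le_integral => //.
- by apply/measurable_EFinP; apply: (measurableT_comp (measurable_powR _)) => //; exact: measurableT_comp.
- by apply/measurable_EFinP; apply: (measurableT_comp (measurable_powR _)) => //; exact: measurableT_comp.
move=> x _; rewrite /= lee_fin.
have /andP[f0 fg'] := fg x.
by rewrite ge0_ler_powR ?nnegrE ?(ltW p0)// !ger0_norm ?(le_trans f0 fg').
Qed.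

Lemma Lnorm_cmodD f g : f \in cLfun -> g \in cLfun ->
  ('N[mu]_p%:E[EFin \o cmod (f + g)%R] <=
   'N[mu]_p%:E[EFin \o cmod f] + 'N[mu]_p%:E[EFin \o cmod g])%E.
Proof.
move=> /cLfunP[fr fi _] /cLfunP[gr gi _].
have mf := measurable_cmod fr fi; have mg := measurable_cmod gr gi.
apply: le_trans (eminkowski mu mf mg p1E).
apply: le_Lnorm; last by move=> x; rewrite cmod_ge0 cmodD.
  apply: measurable_cmod.
    rewrite (_ : _ \o _ = (Re \o f) \+ (Re \o g)); first exact: measurable_funD.
    by apply/funext => x; rewrite /= raddfD.
  rewrite (_ : _ \o _ = (Im \o f) \+ (Im \o g)); first exact: measurable_funD.
  by apply/funext => x; rewrite /= raddfD.
exact: measurable_funD.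
Qed.

Lemma cLfun_mod f : f \in cLfun -> cmod f \in Lfun mu p%:E.
Proof.
move=> /cLfunP[fr fi nf]; rewrite inE; apply/andP; split; apply: mem_set => //=.
exact: measurable_cmod.
Qed.

Lemma Lnorm_cmodZ a f : f \in cLfun ->
  ('N[mu]_p%:E[EFin \o cmod (a *: f)%R] =
   (Normc.normc a)%:E * 'N[mu]_p%:E[EFin \o cmod f])%E.
Proof.
move=> /cLfun_mod mf; rewrite cmodZ.
have := LnormZ (Lfun_Sub p1E mf) (Normc.normc a).
rewrite /= ger0_norm//.
by case: a => x y; exact: sqrtr_ge0.
Qed.

Lemma cLfun_submod_closed : submod_closed cLfun.
Proof.
split.
  apply/cLfunP; split.
  - rewrite (_ : _ \o _ = cst 0)//; exact: measurable_cst.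
  - rewrite (_ : _ \o _ = cst 0)//; exact: measurable_cst.
  rewrite (_ : cmod 0 = cst 0); first exact: finite_norm_cst0.
  by apply/funext => x; rewrite /cmod patchE; case: ifP => //= _; exact: Normc.normc0.
have Zc a f : f \in cLfun -> a *: f \in cLfun.
  move=> fL; have /cLfunP[fr fi nf] := fL; apply/cLfunP; split.
  - rewrite (_ : _ \o _ = (Re a \*: (Re \o f)) \- (Im a \*: (Im \o f))).
      by apply: measurable_funB; apply: measurable_funM => //; exact: measurable_cst.
    by apply/funext => x /=; rewrite [(a *: f) x]/(a * f x); case: (a) (f x) => [? ?] [? ?].
  - rewrite (_ : _ \o _ = (Re a \*: (Im \o f)) \+ (Im a \*: (Re \o f))).
      by apply: measurable_funD; apply: measurable_funM => //; exact: measurable_cst.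
    by apply/funext => x /=; rewrite [(a *: f) x]/(a * f x); case: (a) (f x) => [? ?] [? ?].
  by rewrite /finite_norm Lnorm_cmodZ// lte_mul_pinfty// lee_fin; case: (a) => ? ?; exact: sqrtr_ge0.
move=> a f g /(Zc a); move: (a *: f) => {a}f fL gL.
have /cLfunP[fr fi nf] := fL; have /cLfunP[gr gi ng] := gL.
apply/cLfunP; split.
- rewrite (_ : _ \o _ = (Re \o f) \+ (Re \o g)); first exact: measurable_funD.
  by apply/funext => x; rewrite /= raddfD.
- rewrite (_ : _ \o _ = (Im \o f) \+ (Im \o g)); first exact: measurable_funD.
  by apply/funext => x; rewrite /= raddfD.
- by apply: le_lt_trans (Lnorm_cmodD fL gL) _; exact: lte_add_pinfty.
Qed.

End cLfun.

Record cLfunType d (T : measurableType d) (R : realType)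
    (mu : {measure set T -> \bar R}) (D : set T) (mD : measurable D)
    (p : R) (p1 : 1 <= p) := CLfunType {
  cLfun_fun :> T -> R[i] ;
  cLfun_funP : cLfun_fun \in cLfun mu D p }.

Section cLspace.
Context d (T : measurableType d) (R : realType).
Variables (mu : {measure set T -> \bar R}) (D : set T) (mD : measurable D).
Variables (p : R) (p1 : 1 <= p).
Local Notation fT := (cLfunType mu mD p1).

#[local] HB.instance Definition _ := GRing.isSubmodClosed.Build _ _ (cLfun mu D p)
  (cLfun_submod_closed mu mD p1).

HB.instance Definition _ := [isSub for @cLfun_fun d T R mu D mD p p1].
HB.instance Definition _ := [Choice of fT by <:].
HB.instance Definition _ := [SubChoice_isSubLmodule of fT by <:].

Definition cLnull : {pred fT} := [pred f : fT |
  `[< {ae mu, forall x, D x -> f x = 0} >]].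

Lemma cLnull_submod_closed : submod_closed cLnull.
Proof.
split; first by apply/asboolP; exact: aeW.
move=> a f g /asboolP f0 /asboolP g0; apply/asboolP.
apply: filterS2 f0 g0 => x f0 g0 Dx /=.
by rewrite -[LHS]/(a * f x + g x) f0// g0// mulr0 addr0.
Qed.

HB.instance Definition _ := GRing.isSubmodClosed.Build _ _ cLnull
  cLnull_submod_closed.

(* Complex L^p(D, mu): p-integrable functions modulo equality a.e. on D. The
   library's LspaceType is real-valued and has no vector space structure. *)
Definition cLspace : Type := Quotient.quot cLnull.

HB.instance Definition _ := GRing.Zmodule.on cLspace.
HB.instance Definition _ := ZmodQuotient.on cLspace.
HB.instance Definition _ := Choice.on cLspace.

Definition cLspace_scale (a : R[i]) (f : cLspace) : cLspace :=
  \pi_cLspace (a *: repr f).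

Lemma cLspace_eqP (f g : fT) : (\pi_cLspace f = \pi_cLspace g) <->
  {ae mu, forall x, D x -> f x = g x}.
Proof.
split=> [/eqP|fg].
  rewrite -Quotient.idealrBE => /asboolP; apply: filterS => x fg Dx.
  by apply/eqP; rewrite -subr_eq0 -[_ - _]/((f - g) x) fg.
apply/eqP; rewrite -Quotient.idealrBE; apply/asboolP; move: fg.
by apply: filterS => x fg Dx; rewrite -[LHS]/(f x - g x) fg// subrr.
Qed.

Lemma pi_cLspace_scale a (f : fT) :
  cLspace_scale a (\pi_cLspace f) = \pi_cLspace (a *: f).
Proof.
symmetry; rewrite /cLspace_scale; apply/cLspace_eqP.
have /cLspace_eqP : \pi_cLspace (repr (\pi_cLspace f)) = \pi_cLspace f by rewrite reprK.
by apply: filterS => x fE Dx; rewrite -[LHS]/(a * f x) -fE.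
Qed.

Lemma cLspace_scaleA a b v :
  cLspace_scale a (cLspace_scale b v) = cLspace_scale (a * b) v.
Proof.
elim/quotW: v => v.
by rewrite (pi_cLspace_scale b v) !(pi_cLspace_scale _ (_ : fT)) scalerA. Qed.

Lemma cLspace_scale1 : left_id 1 cLspace_scale.
Proof. by elim/quotW => v; rewrite pi_cLspace_scale scale1r. Qed.

Lemma cLspace_scaleDr : right_distributive cLspace_scale +%R.
Proof.
move=> a; elim/quotW => u; elim/quotW => v.
by rewrite -raddfD !pi_cLspace_scale -raddfD scalerDr.
Qed.

Lemma cLspace_scaleDl v : {morph cLspace_scale^~ v : a b / a + b}.
Proof.
move=> a b /=; elim/quotW: v => v.
by rewrite !pi_cLspace_scale -raddfD scalerDl.
Qed.

HB.instance Definition _ := GRing.Zmodule_isLmodule.Build R[i] cLspace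
  cLspace_scaleA cLspace_scale1 cLspace_scaleDr cLspace_scaleDl.

Definition cLspace_norm (f : cLspace) : R[i] :=
  (fine 'N[mu]_p%:E[EFin \o cmod D (repr f)])%:C.

Lemma cLfun_normE (f : fT) : (fine 'N[mu]_p%:E[EFin \o cmod D f])%:E
  = 'N[mu]_p%:E[EFin \o cmod D f]%E.
Proof.
rewrite fineK// ge0_fin_numE ?Lnorm_ge0//.
by case: f => f /= /cLfunP[].
Qed.

Lemma cLspace_norm_pi (f : fT) : cLspace_norm (\pi f) =
   (fine 'N[mu]_p%:E[EFin \o cmod D f])%:C.
Proof.
have mcmod (g : fT) : measurable_fun setT (cmod D g).
  by have /cLfunP[? ? _] := cLfun_funP g; exact: measurable_cmod.
rewrite /cLspace_norm; congr (fine _)%:C; rewrite unlock /Lnorm; congr poweR.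
apply: ge0_ae_eq_integral => //.
- apply/measurable_EFinP; apply: (measurableT_comp (measurable_powR _)) => //.
  exact: measurableT_comp.
- apply/measurable_EFinP; apply: (measurableT_comp (measurable_powR _)) => //.
  exact: measurableT_comp.
- by move=> x _; exact: poweR_ge0.
- by move=> x _; exact: poweR_ge0.
have /cLspace_eqP : \pi_cLspace (repr (\pi_cLspace f)) = \pi_cLspace f.
  by rewrite reprK.
apply: filterS => x fE _; rewrite /= /cmod !patchE.
by case: ifP => //= /set_mem Dx; rewrite fE.
Qed.

Lemma cLspace_normD u v : cLspace_norm (u + v) <= cLspace_norm u + cLspace_norm v.
Proof.
have [f ->] : exists f : fT, u = \pi_cLspace f by exists (repr u); rewrite reprK.
have [g ->] : exists f : fT, v = \pi_cLspace f by exists (repr v); rewrite reprK.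
rewrite -raddfD !cLspace_norm_pi.
rewrite -rmorphD/= lecR -lee_fin EFinD.
have -> := cLfun_normE (f + g); rewrite !cLfun_normE.
exact: (Lnorm_cmodD mD p1 (cLfun_funP f) (cLfun_funP g)).
Qed.

Lemma cLspace_normZ a u : cLspace_norm (a *: u) = `|a| * cLspace_norm u.
Proof.
have [f ->] : exists f : fT, u = \pi_cLspace f by exists (repr u); rewrite reprK.
rewrite [_ *: _]pi_cLspace_scale !cLspace_norm_pi.
have -> := Lnorm_cmodZ mD p1 a (cLfun_funP f).
by rewrite -cLfun_normE/= -rmorphM.
Qed.

Lemma cLspace_norm0 u : cLspace_norm u = 0 -> u = 0.
Proof.
move=> [/eqP]; rewrite -eqe cLfun_normE => /eqP u0.
have /cLfunP[mr mi _] := cLfun_funP (repr u).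
rewrite -[u]reprK -(raddf0 \pi_cLspace); apply/cLspace_eqP.
have /measurable_EFinP mu_ := measurable_cmod mD mr mi.
have := Lnorm_eq0_eq0 mu_ _ u0; rewrite lte_fin => /(_ (lt_le_trans ltr01 p1)).
apply: filterS => x /(_ I) + Dx; rewrite /= /cmod patchE mem_set//= => -[].
exact: Normc.eq0_normc.
Qed.

HB.instance Definition _ := @Lmodule_isNormed.Build R[i] cLspace cLspace_norm
  cLspace_normD cLspace_normZ cLspace_norm0.

End cLspace.

Definition bounded_operator (K : numFieldType) (E : normedModType K)
    (X : E -> E) : Prop :=
  exists M : K, forall f, `|X f| <= M * `|f|.

Definition extended_eigenvalue (R : realType) (E : normedModType R[i])
    (T : E -> E) (lambda : R[i]) : Prop :=
  exists X : {linear E -> E}, [/\ bounded_operator X, exists f, X f != 0 &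
    forall f, T (X f) = lambda *: X (T f)].

Section cesaro.
Variable R : realType.
Local Notation mu := (@lebesgue_measure R).

Definition cintegral (A : set R) (f : R -> R[i]) : R[i] :=
  (\int[mu]_(t in A) complex.Re (f t)) +i* (\int[mu]_(t in A) complex.Im (f t)).

(* 0^-1 = 0, so the value at x = 0 is 0; it does not matter a.e. *)
Definition cesaro_fun (f : R -> R[i]) (x : R) : R[i] :=
  (x^-1)%:C * cintegral `[0, x] f.

Definition Lp01 (p : R) (p1 : 1 <= p) : normedModType R[i] :=
  cLspace mu (measurable_itv `[0, 1]) p1.

(* The default value 0 of insubd is never reached: since 1 < p, Hardy's
   inequality says that cesaro_fun maps p-integrable functions to p-integrable
   functions. The result does not depend on the representative, as functions
   that agree a.e. on [0, 1] have the same integral on [0, x] for 0 <= x <= 1. *)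
Definition cesaro_op (p : R) (p1 : 1 < p) (f : Lp01 (ltW p1)) : Lp01 (ltW p1) :=
  \pi_(cLspace mu (measurable_itv `[0, 1]) (ltW p1))
    (insubd (0 : cLfunType mu (measurable_itv `[0, 1]) (ltW p1))
       (cesaro_fun (repr f))).

End cesaro.
Arguments cesaro_op {R p} p1 f.

(* Main.v *)
Require Import Defs.
From mathcomp Require Import all_boot all_order all_algebra complex.
From mathcomp Require Import all_classical all_reals all_analysis.
From mathcomp Require Import measurable_realfun ring lra.
Import Order.TTheory GRing.Theory Num.Theory.
Import numFieldNormedType.Exports.
Set Implicit Arguments.
Unset Strict Implicit.
Unset Printing Implicit Defensive.
Local Open Scope classical_set_scope.
Local Open Scope ring_scope.

(* For Re w > 1 - 1/p the function x^(w-1) is an eigenfunction of C_1 for 1/w,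
   and C_1 is injective without eigenvalue z such that Re (1/z) < 1 - 1/p. If
   C_1 X = lambda X C_1 with X != 0, then lambda != 0 by injectivity, and X maps
   x^(w-1) to an eigenfunction for lambda/w, or to 0; it is 0 as soon as
   Re (w/lambda) < 1 - 1/p. Unless 1/lambda is a real number >= 1, this happens
   for all w + t with t in a segment [0, d], for some w.
   The kernel of X, closed under dominated limits, then contains x^(w-1) x^t
   for t in [0, 2d], because (2 x^(t/n) - 1)^n tends to x^(2t) within [-1, 1];
   hence for all t >= 0; hence x^(w-1) 1_[0,b), because (1 - x^n)^N tends to
   1_[0,b) for N close to n b^(-n); hence everything, so that X = 0. *)

(** * Complex L^p functions and kernels of bounded operators *)

(** The number s = 1 - 1/p plays two roles: x^(w-1) lies in L^p as soon as Re w > s, and by Hölder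
    the primitive of an L^p function is O(x^s) at 0, which is what excludes the eigenfunctions on
    the other side of the threshold. The obstacle is density: the kernel of X is only known to
    contain the powers whose exponents fill a short segment. One could continue w -> X (x^(w-1))
    analytically; here the doubling of exponents does that work, so that dominated convergence is
    the only limit theorem needed for the kernel. Real shifts of w suffice because x^(w+t-1) =
    x^(w-1) x^t: once the factor x^(w-1) is frozen, the generation of functions concerns bounded
    real functions on (0, 1], with a multiple of |x^(w-1)| as dominating function. *)

Section Normc_facts.
Context {R : rcfType}.
Implicit Types z w : R[i].

Lemma normc_ge0 z : 0 <= Normc.normc z.
Proof. by case: z => a b; exact: sqrtr_ge0. Qed.

Lemma normcE z : `|z| = (Normc.normc z)%:C%C.
Proof. by case: z. Qed.

Lemma normc_le_add z w : Normc.normc (z + w) <= Normc.normc z + Normc.normc w.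
Proof. by rewrite -lecR rmorphD/= -!normcE ler_normD. Qed.

Lemma normcN z : Normc.normc (- z) = Normc.normc z.
Proof. by case: z => a b /=; rewrite !sqrrN. Qed.

Lemma normc_real (a : R) : Normc.normc a%:C%C = `|a|.
Proof. by rewrite /= expr0n addr0 sqrtr_sqr. Qed.

Lemma normc_ge_Re z : `|complex.Re z| <= Normc.normc z.
Proof. by case: z => a b /=; rewrite -sqrtr_sqr ler_sqrt ?lerDl ?addr_ge0 ?sqr_ge0. Qed.

Lemma normc_ge_Im z : `|complex.Im z| <= Normc.normc z.
Proof. by case: z => a b /=; rewrite -sqrtr_sqr ler_sqrt ?lerDr ?addr_ge0 ?sqr_ge0. Qed.

Lemma normc_le_ReIm z : Normc.normc z <= `|complex.Re z| + `|complex.Im z|.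
Proof.
case: z => a b /=; rewrite -(ler_pXn2r (n := 2))// ?nnegrE ?sqrtr_ge0 ?addr_ge0//.
rewrite sqr_sqrtr ?addr_ge0 ?sqr_ge0// sqrrD !real_normK ?num_real//.
by rewrite lerD2r lerDl mulrn_wge0// mulr_ge0.
Qed.

End Normc_facts.

Lemma powR_cvg0_seq {R : realType} (u : R^nat) (a : R) : 0 < a ->
  (forall n, 0 <= u n) -> u n @[n --> \oo] --> (0:R) ->
  (u n) `^ a @[n --> \oo] --> (0:R).
Proof.
move=> a0 u0 /cvgrPdist_le cu; apply/cvgrPdist_le => e e0.
have d0 : 0 < e `^ a^-1 by rewrite powR_gt0.
have := cu _ d0; apply: filterS => n.
rewrite !sub0r !normrN !ger0_norm ?powR_ge0// => h.
rewrite -[leRHS](powRr1 (ltW e0)) -(mulVf (lt0r_neq0 a0)) powRrM.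
by rewrite ge0_ler_powR ?nnegrE ?powR_ge0// ltW.
Qed.

Section cLfun_facts.
Context d (T : measurableType d) (R : realType).
Variables (mu : {measure set T -> \bar R}) (D : set T) (mD : measurable D).
Variables (p : R) (p1 : 1 <= p).
Implicit Types f g : T -> R[i].

Let p0 : 0 < p. Proof. exact: lt_le_trans p1. Qed.

Lemma Lnorm_cmodE f : ('N[mu]_p%:E[EFin \o cmod D f] =
  (\int[mu]_(x in D) ((Normc.normc (f x)) `^ p)%:E) `^ p^-1)%E.
Proof.
rewrite unlock /Lnorm [in RHS]integral_mkcond; congr (_ `^ _)%E.
apply: eq_integral => x _; rewrite /cmod /= !patchE.
case: ifPn => xD /=; last by rewrite normr0 powR0 ?gt_eqF.
by rewrite ger0_norm ?normc_ge0.
Qed.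

Lemma cLfun_integralP f : (f \in cLfun mu D p) <->
  [/\ measurable_fun D (@complex.Re R \o f),
      measurable_fun D (@complex.Im R \o f) &
      (\int[mu]_(x in D) ((Normc.normc (f x)) `^ p)%:E < +oo)%E].
Proof.
have I0 : (0 <= \int[mu]_(x in D) ((Normc.normc (f x)) `^ p)%:E)%E.
  by apply: integral_ge0 => x _; rewrite lee_fin powR_ge0.
split=> [/cLfunP[mr mi]|[mr mi fi]].
  rewrite /finite_norm Lnorm_cmodE => fi; split => //.
  by apply: lty_poweRy fi; rewrite invr_neq0// gt_eqF.
apply/cLfunP; split => //; rewrite /finite_norm Lnorm_cmodE.
by rewrite poweR_lty.
Qed.

Lemma measurable_normc f :
  measurable_fun D (@complex.Re R \o f) ->
  measurable_fun D (@complex.Im R \o f) ->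
  measurable_fun D (fun x => Normc.normc (f x)).
Proof.
move=> mr mi; have := measurable_cmod mD mr mi.
by move=> /(measurable_restrictT _ mD).
Qed.

Lemma measurable_normc_powR f :
  measurable_fun D (@complex.Re R \o f) ->
  measurable_fun D (@complex.Im R \o f) ->
  measurable_fun D (fun x => ((Normc.normc (f x)) `^ p)%:E).
Proof.
move=> mr mi; apply/measurable_EFinP.
apply: (measurableT_comp (measurable_powR p)); exact: measurable_normc.
Qed.

Lemma cLfun_le f g : g \in cLfun mu D p ->
  measurable_fun D (@complex.Re R \o f) ->
  measurable_fun D (@complex.Im R \o f) ->
  (forall x, D x -> Normc.normc (f x) <= Normc.normc (g x)) ->
  f \in cLfun mu D p.
Proof.
move=> /cLfun_integralP[gr gi gfin] fr fi fg.
apply/cLfun_integralP; split; [exact: fr|exact: fi|].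
apply: le_lt_trans gfin; apply: ge0_le_integral => //.
- by move=> x Dx; rewrite lee_fin powR_ge0.
- exact: measurable_normc_powR.
- exact: measurable_normc_powR.
- by move=> x Dx; rewrite lee_fin ge0_ler_powR ?nnegrE ?normc_ge0 ?fg// ltW.
Qed.

End cLfun_facts.

(** * The kernel of a bounded operator under linear combinations and dominated limits *)

Section kernel_closure.
Context d (T : measurableType d) (R : realType).
Variables (mu : {measure set T -> \bar R}) (D : set T) (mD : measurable D).
Variables (p : R) (p1 : 1 <= p).
Local Notation E := (cLspace mu mD p1).
Variables (X : {linear E -> E}) (bX : bounded_operator X).
Implicit Types f g : T -> R[i].

Let p0 : 0 < p. Proof. exact: lt_le_trans p1. Qed.

Definition cLclass f (Pf : f \in cLfun mu D p) : E :=
  (\pi_(cLspace mu mD p1) (CLfunType mD p1 Pf))%qT.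

Lemma cLclassP a f g (Pf : f \in cLfun mu D p) (Pg : g \in cLfun mu D p)
    (P : a *: f + g \in cLfun mu D p) :
  cLclass P = a *: cLclass Pf + cLclass Pg.
Proof.
rewrite /cLclass (_ : CLfunType mD p1 P =
  a *: CLfunType mD p1 Pf + CLfunType mD p1 Pg); last exact: val_inj.
by rewrite raddfD/= -pi_cLspace_scale.
Qed.

(** A predicate on functions rather than on classes, so that elements of the kernel can be combined
    and passed to the limit pointwise; integrability is packed in the existential. *)
Definition ker_fun f : Prop := exists Pf : f \in cLfun mu D p, X (cLclass Pf) = 0.

Lemma ker_fun_cLfun f : ker_fun f -> f \in cLfun mu D p.
Proof. by case. Qed.

Lemma ker_fun_lin a f g : ker_fun f -> ker_fun g -> ker_fun (a *: f + g).
Proof.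
move=> [Pf Xf] [Pg Xg].
have P : a *: f + g \in cLfun mu D p.
  exact: (cLfun_submod_closed mu mD p1).2.
by exists P; rewrite (cLclassP Pf Pg) linearP Xf Xg scaler0 addr0.
Qed.

Lemma ker_fun_eq f g : (forall x, D x -> f x = g x) -> ker_fun f -> ker_fun g.
Proof.
move=> fg [Pf Xf].
have [fr fi ff] := (cLfun_integralP mu D p1 f).1 Pf.
have Pg : g \in cLfun mu D p.
  apply/(cLfun_integralP mu D p1); split.
  - by apply: eq_measurable_fun fr => x /set_mem Dx /=; rewrite fg.
  - by apply: eq_measurable_fun fi => x /set_mem Dx /=; rewrite fg.
  - apply: le_lt_trans ff; rewrite le_eqVlt; apply/orP; left; apply/eqP.
    by apply: eq_integral => x /set_mem Dx; rewrite fg.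
exists Pg; rewrite -Xf; congr (X _); apply/cLspace_eqP; apply: aeW => x Dx /=.
by rewrite fg.
Qed.

(** By linearity X sends f_n - f to - X f, so |X f| is at most M times the norm of f_n - f, for
    every n. *)
Lemma ker_fun_closed (f_ : (T -> R[i])^nat) f : f \in cLfun mu D p ->
  (forall n, ker_fun (f_ n)) ->
  (\int[mu]_(x in D) ((Normc.normc (f_ n x - f x)) `^ p)%:E)%E @[n --> \oo] --> 0%E ->
  ker_fun f.
Proof.
move=> Pf kf cvg0; exists Pf; set F := cLclass _.
case: bX => M XM.
pose r n := fine (\int[mu]_(x in D) ((Normc.normc (f_ n x - f x)) `^ p)%:E)%E `^ p^-1.
have XFle n : `|X F| <= M * (r n)%:C%C.
  have [Pn Xn] := kf n.
  have Pd : f_ n - f \in cLfun mu D p.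
    have := (cLfun_submod_closed mu mD p1).2 (-1) _ _ Pf Pn.
    by rewrite scaleN1r addrC.
  have -> : `|X F| = `|X (cLclass Pd)|.
    have Pd' : (-1) *: f + f_ n \in cLfun mu D p by rewrite scaleN1r addrC.
    have -> : cLclass Pd = cLclass Pd'.
      by apply/cLspace_eqP; apply: aeW => x _ /=; rewrite scaleN1r addrC.
    by rewrite (cLclassP Pf Pn) linearP Xn addr0 scaleN1r normrN.
  apply: le_trans (XM _) _; rewrite le_eqVlt; apply/orP; left; apply/eqP; congr (_ * _).
  rewrite [LHS]cLspace_norm_pi /= Lnorm_cmodE//; congr (_%:C)%C.
  rewrite /r; have /cLfun_integralP[//|_ _ fin] := Pd.
  rewrite -[X in fine (X `^ _)]fineK ?poweR_EFin//.
  by rewrite ge0_fin_numE// integral_ge0// => x _; rewrite lee_fin powR_ge0.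
have r0 : r n @[n --> \oo] --> (0:R).
  apply: powR_cvg0_seq; [by rewrite invr_gt0| |exact: fine_cvg cvg0].
  by move=> n; rewrite fine_ge0// integral_ge0// => x _; rewrite lee_fin powR_ge0.
apply/eqP; rewrite -normr_eq0.
(* The bound [M] is a complex scalar, so both sides are replaced by their moduli before a limit is
   taken in [R]. *)
have Nle n : Normc.normc `|X F| <= Normc.normc M * r n.
  have h := XFle n.
  have : `| `|X F| | <= `|M * (r n)%:C%C|.
    by rewrite normr_id (ger0_norm (le_trans (normr_ge0 _) h)).
  rewrite !normrM [X in _ <= _ * X]ger0_norm ?lecR ?powR_ge0//.
  by rewrite !normcE -rmorphM/= lecR.
have : Normc.normc `|X F| <= 0.
  have c : Normc.normc M * r n @[n --> \oo] --> Normc.normc M * 0.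
    by apply: cvgM => //; exact: cvg_cst.
  rewrite -(mulr0 (Normc.normc M)) -(cvg_lim _ c)//.
  by apply: limr_ge; [exact: cvgP c|exact: nearW].
rewrite -lecR -normcE normr_id => h.
by rewrite eq_le h normr_ge0.
Qed.

(** The bound |f| <= |g| survives in the limit, so f is in L^p, and |f_n - f|^p <= |2 g|^p permits
    dominated convergence. The dominating [g] is complex and enters by its modulus: a multiple of
    x^(w-1), or the target function itself, can serve. *)
Lemma ker_fun_dct (f_ : (T -> R[i])^nat) f g :
  (forall n, ker_fun (f_ n)) -> g \in cLfun mu D p ->
  (forall n x, D x -> Normc.normc (f_ n x) <= Normc.normc (g x)) ->
  (forall x, D x -> Normc.normc (f_ n x - f x) @[n --> \oo] --> (0:R)) ->
  ker_fun f.
Proof.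
move=> kf Pg fg f_f.
have Pn n := ker_fun_cLfun (kf n).
have /(cLfun_integralP _ _ p1)[gr gi gfin] := Pg.
have cRe x : D x -> complex.Re (f_ n x) @[n --> \oo] --> complex.Re (f x).
  move=> Dx; apply/cvgrPdist_le => e e0.
  have /cvgrPdist_le /(_ e e0) := f_f x Dx.
  apply: filterS => n; rewrite sub0r normrN ger0_norm ?normc_ge0//.
  rewrite distrC; apply: le_trans.
  by have := normc_ge_Re (f_ n x - f x); rewrite raddfB.
have cIm x : D x -> complex.Im (f_ n x) @[n --> \oo] --> complex.Im (f x).
  move=> Dx; apply/cvgrPdist_le => e e0.
  have /cvgrPdist_le /(_ e e0) := f_f x Dx.
  apply: filterS => n; rewrite sub0r normrN ger0_norm ?normc_ge0//.
  rewrite distrC; apply: le_trans.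
  by have := normc_ge_Im (f_ n x - f x); rewrite raddfB.
have mfr : measurable_fun D (@complex.Re R \o f).
  apply: (measurable_fun_cvg (h := fun n x => complex.Re (f_ n x))) => [n|x Dx]; last exact: cRe.
  by have /(cLfun_integralP _ _ p1)[] := Pn n.
have mfi : measurable_fun D (@complex.Im R \o f).
  apply: (measurable_fun_cvg (h := fun n x => complex.Im (f_ n x))) => [n|x Dx]; last exact: cIm.
  by have /(cLfun_integralP _ _ p1)[] := Pn n.
have ffg x : D x -> Normc.normc (f x) <= Normc.normc (g x).
  move=> Dx.
  have : Normc.normc (g x) + Normc.normc (f_ n x - f x) @[n --> \oo] --> Normc.normc (g x) + 0.
    by apply: cvgD; [exact: cvg_cst|exact: f_f].
  rewrite addr0 => c; rewrite -(cvg_lim _ c)//.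
  apply: limr_ge; [exact: cvgP c|apply: nearW => n].
  rewrite -[X in Normc.normc X <= _](subKr (f_ n x)).
  apply: le_trans (normc_le_add _ _) _; rewrite normcN lerD2r; exact: fg.
have Pf : f \in cLfun mu D p by exact: cLfun_le Pg mfr mfi ffg.
apply: ker_fun_closed Pf kf _.
have Pgg : (2 : R[i]) *: g \in cLfun mu D p.
  by rewrite -[_ *: _]addr0 (cLfun_submod_closed mu mD p1).2// (cLfun_submod_closed mu mD p1).1.
have /(cLfun_integralP _ _ p1)[ggr ggi ggfin] := Pgg.
have H := @dominated_convergence _ _ _ mu D mD
  (fun n x => ((Normc.normc (f_ n x - f x)) `^ p)%:E) (cst 0%E)
  (fun x => ((Normc.normc (((2 : R[i]) *: g) x)) `^ p)%:E).
rewrite -(integral0 mu D); case: H => [| | | | |_ _]; last by [].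
- move=> n; have /(cLfun_integralP _ _ p1)[ar ai _] := Pn n.
  apply: (measurable_normc_powR mD p (f := f_ n \- f)).
    rewrite (_ : _ \o _ = (@complex.Re R \o f_ n) \- (@complex.Re R \o f)).
      exact: measurable_funB.
    by apply/funext => x /=; rewrite raddfB.
  rewrite (_ : _ \o _ = (@complex.Im R \o f_ n) \- (@complex.Im R \o f)).
    exact: measurable_funB.
  by apply/funext => x /=; rewrite raddfB.
- exact: measurable_cst.
- apply: aeW => x Dx; apply/fine_cvgP; split; first exact: nearW.
  by apply: powR_cvg0_seq => // [n|]; [exact: normc_ge0|exact: f_f].
- apply/integrableP; split; first exact: measurable_normc_powR.
  by under eq_integral => x _ do rewrite gee0_abs ?lee_fin ?powR_ge0//.
- apply: aeW => x n Dx; rewrite /= lee_fin ger0_norm ?powR_ge0//.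
  rewrite ge0_ler_powR ?nnegrE ?normc_ge0 ?(ltW p0)//.
  apply: le_trans (normc_le_add _ _) _; rewrite normcN.
  rewrite -[(_ *: _) x]/(2 * g x) Normc.normcM.
  rewrite (_ : Normc.normc 2 = 2); last first.
    by rewrite -[2 in LHS](rmorph_nat (real_complex R)) normc_real ger0_norm.
  by rewrite mulr_natl mulr2n lerD ?fg ?ffg.
Qed.

End kernel_closure.

(** * Functions generated by the powers under bounded limits *)

(** The cofactor of a - b in a^n - b^n is a sum of n products of modulus at most 1. The bound is
    used for bases so close that n times their difference tends to 0. *)
Lemma normrB_expn_le {R : realDomainType} (a b : R) n : `|a| <= 1 -> `|b| <= 1 ->
  `|a ^+ n - b ^+ n| <= n%:R * `|a - b|.
Proof.
move=> a1 b1; rewrite subrXX normrM mulrC ler_wpM2r//.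
apply: le_trans (ler_norm_sum _ _ _) _.
rewrite -[n in leRHS]card_ord -sumr_const ler_sum// => i _.
by rewrite normrM !normrX mulr_ile1// ?exprn_ge0// exprn_ile1.
Qed.

Lemma onem_powR_le {R : realType} (x u : R) : 0 < x -> 1 - x `^ u <= - (u * ln x).
Proof.
move=> x0; rewrite /powR gt_eqF// lerBlDl -lerBlDr opprK.
exact: expR_ge1Dx.
Qed.

Section bounded_pointwise_closure.
Context {R : realType}.
(** [W f] stands for: x^(w-1) f lies in the kernel of X. Only the values of f on (0, 1] matter. *)
Variable W : (R -> R) -> Prop.
Hypothesis Wlin : forall (a : R) f g, W f -> W g -> W (fun x => a * f x + g x).
Hypothesis Wdct : forall (f_ : (R -> R)^nat) (f : R -> R) (B : R), (forall n, W (f_ n)) ->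
  (forall n (x : R), 0 < x <= 1 -> `|f_ n x| <= B) ->
  (forall x : R, 0 < x <= 1 -> f_ n x @[n --> \oo] --> f x) -> W f.

(** The constant sequence f converges to g on (0, 1], so the limit hypothesis also makes [W] blind
    to values elsewhere. *)
Let Weq f g : W f -> (forall x, 0 < x <= 1 -> `|f x| <= 1) ->
  (forall x, 0 < x <= 1 -> f x = g x) -> W g.
Proof.
move=> Wf f1 fg; apply: (Wdct (f_ := fun=> f) (B := 1)) => // x x01.
by rewrite fg//; exact: cvg_cst.
Qed.

(** Linearity only speaks of a f + g, so 0 is reached from some member of [W]; hence the premise
    [W f] here and in [Wsum]. *)
Let W0 f : W f -> W (fun=> 0).
Proof.
move=> Wf; have := Wlin (-1) Wf Wf; congr W; apply/funext => x /=; lra.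
Qed.

Let Wsum (I : eqType) (F : I -> R -> R) (c : I -> R) (s : seq I) f : W f ->
  (forall i, i \in s -> W (F i)) ->
  W (fun x => \sum_(i <- s) c i * F i x).
Proof.
move=> Wf; elim: s => [|i s IH] WF.
  by under eq_fun do rewrite big_nil; exact: W0 Wf.
under eq_fun do rewrite big_cons.
apply: Wlin; first by apply: WF; exact: mem_head.
by apply: IH => j js; apply: WF; rewrite inE js orbT.
Qed.

Let powR_01 (x s : R) : 0 < x <= 1 -> 0 <= s -> 0 < x `^ s <= 1.
Proof.
move=> /andP[x0 x1] s0; rewrite powR_gt0//=.
rewrite [leRHS](_ : 1 = 1 `^ s); last by rewrite powR1.
by rewrite ge0_ler_powR ?nnegrE// ltW.
Qed.

(** Let s be half the target exponent and y = x^(s/(n+1)). Then y^2 - (2 y - 1) = (1 - y)^2, and 1 -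
    y <= - s ln x / (n+1), so the (n+1)-st powers of y^2 and 2 y - 1 differ by at most (s ln x)^2 /
    (n+1); that of y^2 is x^(2 s). *)
Lemma powR_closure_double d : 0 < d ->
  (forall s, 0 <= s <= d -> W (fun x => x `^ s)) ->
  (forall s, 0 <= s <= 2 * d -> W (fun x => x `^ s)).
Proof.
move=> d0 Wd s2 /andP[s0 sd]; pose s := s2 / 2.
have s0' : 0 <= s by rewrite divr_ge0.
have sd' : s <= d by rewrite /s; lra.
pose f_ n (x : R) := (2 * x `^ (s / n.+1%:R) - 1) ^+ n.+1.
have yE x n : (x `^ (s / n.+1%:R)) ^+ n.+1 = x `^ s.
  by rewrite -powR_mulrn ?powR_ge0// -powRrM divfK// pnatr_eq0.
have f1 n x : 0 < x <= 1 -> `|2 * x `^ (s / n.+1%:R) - 1| <= 1.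
  move=> x01; have /andP[y0 y1] : 0 < x `^ (s / n.+1%:R) <= 1.
    by apply: powR_01 => //; rewrite divr_ge0.
  by rewrite ler_norml; lra.
apply: (Wdct (f_ := f_) (B := 1)) => [n|n x x01|x x01].
(* The binomial expansion only involves the exponents s i / (n+1) with i <= n+1, all of them in
   [0, d]. *)
- rewrite /f_ (_ : (fun x => _) = (fun x => \sum_(0 <= i < n.+2)
     ((-1) ^+ (n.+1 - i) * 2 ^+ i *+ 'C(n.+1, i)) * x `^ (s * i%:R / n.+1%:R))).
    have W1 : W (fun x => x `^ 0) by apply: Wd; rewrite lexx ltW.
    apply: (Wsum (F := fun (i : nat) x => x `^ (s * i%:R / n.+1%:R))
      (fun i : nat => (-1) ^+ (n.+1 - i) * 2 ^+ i *+ 'C(n.+1, i)) W1).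
    move=> i; rewrite mem_index_iota /= => i_n; apply: Wd; rewrite divr_ge0 ?mulr_ge0//=.
    apply: le_trans sd'; rewrite ler_pdivrMr// ler_wpM2l// ler_nat.
    by rewrite -ltnS.
  apply/funext => x; rewrite big_mkord addrC exprDn; apply: eq_bigr => i _.
  rewrite exprMn mulrA -mulrnAl; congr (_ * _).
  by rewrite -powR_mulrn ?powR_ge0// -powRrM mulrAC.
- by rewrite /f_ normrX exprn_ile1// f1.
- apply/cvgrPdist_le => e e0.
  have /andP[x0 x1] := x01.
  pose L := s * - ln x.
  have L0 : 0 <= L by rewrite mulr_ge0// oppr_ge0 ln_le0.
  have c : L ^+ 2 / n.+1%:R @[n --> \oo] --> (0:R).
    rewrite -(mulr0 (L ^+ 2)); apply: cvgM; first exact: cvg_cst.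
    exact: cvg_harmonic.
  move/cvgrPdist_le : c => /(_ e e0); apply: filterS => n.
  rewrite sub0r normrN ger0_norm ?divr_ge0 ?sqr_ge0//; apply: le_trans.
  have y01 : 0 < x `^ (s / n.+1%:R) <= 1 by apply: powR_01 => //; rewrite divr_ge0.
  set y := x `^ (s / n.+1%:R) in y01 *.
  have -> : x `^ s2 = (y ^+ 2) ^+ n.+1.
    by rewrite exprAC yE -powR_mulrn ?powR_ge0// -powRrM /s divfK ?pnatr_eq0.
  apply: le_trans (normrB_expn_le _ _ _) _; last first.
  + have -> : y ^+ 2 - (2 * y - 1) = (1 - y) ^+ 2 by ring.
    rewrite normrX ger0_norm ?subr_ge0; last by case/andP: y01.
    have h : 1 - y <= L / n.+1%:R.
      apply: le_trans (onem_powR_le _ x0) _.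
      by rewrite /L mulrN mulNr mulrAC.
    have -> : L ^+ 2 / n.+1%:R = n.+1%:R * (L / n.+1%:R) ^+ 2.
      have F (a m : R) : m != 0 -> a ^+ 2 / m = m * (a / m) ^+ 2.
        by move=> m0; field.
      by apply: F; rewrite pnatr_eq0.
    rewrite ler_wpM2l// ler_pXn2r// ?nnegrE ?subr_ge0 ?divr_ge0//.
    by case/andP: y01.
  + by rewrite /f_; exact: f1.
  + have /andP[/ltW y0 y1] := y01; by rewrite normrX exprn_ile1// ger0_norm.
Qed.

Lemma powR_closure d : 0 < d ->
  (forall s, 0 <= s <= d -> W (fun x => x `^ s)) ->
  forall s, 0 <= s -> W (fun x => x `^ s).
Proof.
move=> d0 Wd s s0.
have H n : forall s, 0 <= s <= 2 ^+ n * d -> W (fun x => x `^ s).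
  elim: n => [|n IH]; first by rewrite mul1r.
  by rewrite exprS -mulrA; apply: powR_closure_double => //; rewrite mulr_gt0// exprn_gt0.
have [n sn] : exists n, s <= 2 ^+ n * d.
  exists (Num.truncn (s / d)).+1; rewrite -ler_pdivrMr//.
  apply/ltW/(lt_le_trans (truncnS_gt _)).
  by rewrite -natrX ler_nat ltnW// ltn_expl.
by apply: (H n); rewrite s0.
Qed.


(** Induction on n with (1 - y) (1 + (n+1) y) <= 1 + n y. It is used as the decay estimate (1 - y)^n
    <= 1 / (1 + n y), and with y = 1 - q as a bound on n q^n. *)
Let onem_expn_harmonic (y : R) n : 0 <= y <= 1 ->
  (1 - y) ^+ n * (1 + n%:R * y) <= 1.
Proof.
move=> /andP[y0 y1]; elim: n => [|n IH]; first by rewrite expr0 mul0r addr0 mul1r.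
apply: le_trans IH; rewrite exprSr -mulrA ler_wpM2l ?exprn_ge0 ?subr_ge0//.
rewrite -natr1; have := mulr_ge0 (ler0n R n) (sqr_ge0 y); have := sqr_ge0 y.
by nra.
Qed.

(** With r = q^2, the previous bound gives n q^n <= 1 / (1 - q), and the second factor q^n tends to
    0. *)
Lemma cvg_mulrn_expr (r : R) : 0 <= r < 1 -> n%:R * r ^+ n @[n --> \oo] --> (0:R).
Proof.
move=> /andP[r0 r1]; pose q := Num.sqrt r.
have q0 : 0 <= q by exact: sqrtr_ge0.
have q1 : q < 1 by rewrite -sqrtr1 ltr_sqrt.
have rE : r = q ^+ 2 by rewrite sqr_sqrtr.
have b n : n%:R * r ^+ n <= (1 - q)^-1 * q ^+ n.
  rewrite rE exprAC expr2 mulrA ler_wpM2r ?exprn_ge0//.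
  rewrite -[leRHS]mulr1 ler_pdivlMl ?subr_gt0//.
  have := @onem_expn_harmonic (1 - q) n; rewrite opprB addrCA subrr addr0.
  have qn0 := exprn_ge0 n q0.
  have -> : 0 <= 1 - q <= 1 by lra.
  move=> /(_ isT); rewrite mulrDr mulr1 [n%:R * (1 - q)]mulrC.
  by rewrite mulrCA [q ^+ n * _]mulrC mulrA; lra.
apply: (@squeeze_cvgr _ _ _ _ (fun=> 0) (fun n => (1 - q)^-1 * q ^+ n)).
- apply: nearW => n; rewrite b andbT mulr_ge0// exprn_ge0//.
- exact: cvg_cst.
- rewrite -[X in _ --> X](mulr0 (1 - q)^-1); apply: cvgM; first exact: cvg_cst.
  by apply: cvg_expr; rewrite ger0_norm.
Qed.

Lemma indic_itv_closure : (forall s, 0 <= s -> W (fun x => x `^ s)) ->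
  forall b : R, W (\1_`]-oo, b[).
Proof.
move=> Wp b.
(* For b <= 0 and for b > 1 the indicator is constant on (0, 1], equal to 0 or to x^0. *)
have [b0|b0] := lerP b 0.
  apply: (Weq (W0 (Wp 0 (lexx 0)))) => x; first by rewrite normr0.
  move=> /andP[x0 _]; rewrite indicE memNset//= in_itv/=.
  by apply/negP; rewrite -leNgt (le_trans b0)// ltW.
have [b1|b1] := ltrP 1 b.
  apply: (Weq (Wp 0 (lexx 0))) => x /andP[x0 x1]; rewrite powRr0 ?normr1//.
  by rewrite indicE mem_set//= in_itv/= (le_lt_trans x1).
(* This choice gives N x^n <= n (x/b)^n + x^n, which tends to 0 for x < b, and N x^n >= n for x >=
   b, which forces (1 - x^n)^N <= 1 / (n+1). The second case includes x = b, so the limit is the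
   indicator of an interval open at b. *)
pose N n := (Num.truncn (n%:R * b ^- n)).+1.
have N1 n : n%:R * b ^- n <= (N n)%:R.
  exact/ltW/truncnS_gt.
have N2 n : (N n)%:R <= n%:R * b ^- n + 1.
  rewrite /N -natr1 lerD2r truncn_le// mulr_ge0// invr_ge0 exprn_ge0// ltW//.
pose f_ n (x : R) := (1 - x `^ n%:R) ^+ N n.
have xn01 n (x : R) : 0 < x <= 1 -> 0 <= x ^+ n <= 1.
  by move=> /andP[/ltW x0 x1]; rewrite exprn_ge0//= exprn_ile1.
apply: (@Wdct f_ (\1_`]-oo, b[) 1) => [n|n x x01|x x01].
- rewrite /f_ (_ : (fun x => _) = (fun x => \sum_(0 <= i < (N n).+1)
     ((-1) ^+ i *+ 'C(N n, i)) * x `^ (n%:R * i%:R))).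
    apply: (Wsum (F := fun (i : nat) x => x `^ (n%:R * i%:R))
      (fun i : nat => (-1) ^+ i *+ 'C(N n, i)) (Wp 0 (lexx 0))) => i _.
    by apply: Wp; rewrite mulr_ge0.
  apply/funext => x; rewrite big_mkord exprDn; apply: eq_bigr => i _.
  rewrite expr1n mul1r [(- (_ `^ _)) ^+ i]exprNn -mulrnAl; congr (_ * _).
  by rewrite -powR_mulrn ?powR_ge0// -powRrM.
- have /andP[x0 x1] := x01.
  rewrite /f_ powR_mulrn ?(ltW x0)// normrX exprn_ile1//.
  by have := xn01 n x x01; rewrite ler_norml; lra.
- have /andP[x0 x1] := x01.
  have fE n : f_ n x = (1 - x ^+ n) ^+ N n by rewrite /f_ powR_mulrn// ltW.
  have [xb|bx] := ltrP x b.
    rewrite indicE mem_set//= ?in_itv//=.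
    have r01 : 0 <= x / b < 1.
      by rewrite divr_ge0 ?(ltW x0) ?(ltW b0)//= ltr_pdivrMr ?mul1r.
    have c : n%:R * (x / b) ^+ n + x ^+ n @[n --> \oo] --> (0 + 0 : R).
      apply: cvgD; first exact: cvg_mulrn_expr.
      by apply: cvg_expr; rewrite ger0_norm ?(ltW x0)// (lt_le_trans xb).
    rewrite addr0 in c; apply/cvgrPdist_le => e e0.
    move/cvgrPdist_le : c => /(_ e e0); apply: filterS => n.
    rewrite sub0r normrN ger0_norm; last first.
      by rewrite addr_ge0 ?mulr_ge0 ?exprn_ge0 ?divr_ge0// ltW.
    apply: le_trans; rewrite fE.
    rewrite (_ : 1 - (1 - x ^+ n) ^+ N n = 1 ^+ N n - (1 - x ^+ n) ^+ N n); last by rewrite expr1n.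
    have /andP[y0 y1] := xn01 n x x01.
    apply: le_trans (normrB_expn_le _ _ _) _; rewrite ?normr1//.
      by rewrite ler_norml; lra.
    rewrite opprB addrCA subrr addr0 ger0_norm//.
    apply: le_trans (ler_wpM2r y0 (N2 n)) _.
    by rewrite mulrDl mul1r expr_div_n mulrA mulrAC.
  rewrite indicE memNset//= ?in_itv//=; last by apply/negP; rewrite -leNgt.
  apply/cvgrPdist_le => e e0.
  have /cvgrPdist_le /(_ e e0) := @cvg_harmonic R.
  apply: filterS => n; rewrite !sub0r !normrN /harmonic/= ger0_norm ?invr_ge0//.
  apply: le_trans; rewrite fE.
  have y01 := xn01 n x x01; have /andP[y0 y1] := y01.
  rewrite ger0_norm ?exprn_ge0 ?subr_ge0// -[leRHS]mul1r ler_pdivlMr//.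
  apply: le_trans (onem_expn_harmonic (N n) y01).
  rewrite ler_wpM2l ?exprn_ge0 ?subr_ge0// -natr1 addrC lerD2l.
  apply: le_trans (ler_wpM2r y0 (N1 n)).
  rewrite -mulrA -[leLHS]mulr1 ler_wpM2l// mulrC ler_pdivlMr ?exprn_gt0// mul1r.
  by apply: lerXn2r => //; rewrite nnegrE ltW.
Qed.

(** Dynkin's theorem: the rays are stable under intersection and generate the Borel sets,
    complements come from linearity and the constant x^0, and disjoint unions from bounded
    limits. *)
Lemma indic_closure : (forall s, 0 <= s -> W (fun x => x `^ s)) ->
  forall A : set R, measurable A -> W \1_A.
Proof.
move=> Wp.
have W1 : W (fun=> 1).
  by have := Wp 0 (lexx 0); congr W; apply/funext => x; rewrite powRr0.
move=> A mA.
apply: (@dynkin_induction _ (measurableTypeR R) (@RGenInftyO.G R) (fun A => W \1_A)).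
- exact: RGenInftyO.measurableE.
- move=> _ _ [a ->] [b ->]; exists (Num.min a b).
  by apply/seteqP; split => x /=; rewrite !in_itv/= lt_min => /andP.
- by rewrite indicT.
- by move=> _ [b ->]; exact: indic_itv_closure.
- move=> S mS WS; have := Wlin (-1) WS W1; congr W; apply/funext => x.
  rewrite !indicE in_setC; case: (x \in S); rewrite /=; lra.
- move=> F mF tF WF.
  apply: (Wdct (f_ := fun n x => \sum_(0 <= i < n) 1 * \1_(F i) x) (B := 1)).
  + by move=> n; apply: (Wsum (F := fun i => \1_(F i)) _ W1) => i _.
  (* Disjointness keeps the partial sums below the indicator of the union, hence below 1. *)
  + move=> n x _; under eq_bigr do rewrite mul1r.
    rewrite ger0_norm ?sumr_ge0// -lee_fin -sumEFin.
    apply: (@le_trans _ _ (\1_(\bigcup_k F k) x)%:E).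
      rewrite indic_bigcup//; apply: nneseries_lim_ge => k _ _.
      by rewrite lee_fin.
    by rewrite lee_fin indicE; case: (_ \in _).
  + move=> x _; under eq_fun do under eq_bigr do rewrite mul1r.
    have F0 k : (0%N <= k)%N -> true -> (0%R <= (\1_(F k) x)%:E :> \bar R)%E.
      by move=> _ _; rewrite lee_fin.
    have := is_cvg_nneseries F0.
    rewrite -(indic_bigcup x tF) => /fine_cvg; apply: cvg_trans.
    by apply: near_eq_cvg; apply: nearW => n; rewrite /= sumEFin.
- have : (@ocitv R).-sigma.-measurable A := mA.
  by rewrite RGenInftyO.measurableE; exact.
Qed.

Import HBSimple HBNNSimple.

Lemma nnsfun_closure : (forall A : set R, measurable A -> W \1_A) ->
  forall f : {nnsfun (measurableTypeR R) >-> R}, W f.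
Proof.
move=> WA f.
have W1 : W \1_[set: R] by exact: WA.
have := Wsum (F := fun y => \1_(f @^-1` [set y])) id W1.
move=> /(_ (finmap.enum_fset (fset_set (range f)))) H.
rewrite (_ : (f : R -> R) = (fun x =>
    \sum_(y <- finmap.enum_fset (fset_set (range f))) y * \1_(f @^-1` [set y]) x)).
  apply: H => y _; apply: WA.
  by rewrite -[X in measurable X]setTI; exact: (@measurable_funPT _ _ _ _ f).
by apply/funext => x; rewrite [LHS]fimfunE fsbig_finite.
Qed.

End bounded_pointwise_closure.

(** * Hardy inequality *)

Lemma powRD_gt0 {R : realType} (r t : R) (x : R) : 0 < x ->
  x `^ (r + t) = x `^ r * x `^ t.
Proof. by move=> x0; rewrite powRD//; apply/implyP => _; rewrite gt_eqF. Qed.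

Section powR_integral.
Context {R : realType}.
Local Notation mu := (@lebesgue_measure R).
Implicit Types a b r x : R.

Lemma continuous_powR_gt0 r x : 0 < x -> {for x, continuous (fun t => t `^ r)}.
Proof.
move=> x0; apply/differentiable_continuous/derivable1_diffP.
by have /@ex_derive := is_derive1_powR r x0.
Qed.

Lemma integral_powR_itvcc r a b : r + 1 != 0 -> 0 < a -> a < b ->
  (\int[mu]_(t in `[a, b]) (t `^ r)%:E =
   ((b `^ (r + 1) - a `^ (r + 1)) / (r + 1))%:E)%E.
Proof.
move=> r1 a0 ab.
have D x : 0 < x -> is_derive x 1 (fun t => t `^ (r + 1) / (r + 1)) (x `^ r).
  move=> x0; have := is_derive1_powR (r + 1) x0; rewrite addrK => h.
  have := is_deriveZ (r + 1)^-1 h.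
  rewrite scalerA mulVf// scale1r; congr is_derive.
  by apply/funext => t /=; rewrite mulrC.
have cF x : 0 < x -> {for x, continuous (fun t => t `^ (r + 1) / (r + 1))}.
  move=> x0; apply/differentiable_continuous/derivable1_diffP.
  by have /@ex_derive := D x x0.
rewrite (@continuous_FTC2 _ (fun t => t `^ r) (fun t => t `^ (r + 1) / (r + 1)))//.
- by rewrite -EFinB mulrBl.
- apply: continuous_in_subspaceT => x; rewrite inE/= in_itv/= => /andP[ax _].
  by apply: continuous_powR_gt0; exact: lt_le_trans ax.
- split.
  + move=> x; rewrite in_itv/= => /andP[ax _].
    by have /@ex_derive := D x (lt_trans a0 ax).
  + by apply: cvg_at_right_filter; exact: cF.
  + by apply: cvg_at_left_filter; apply: cF; exact: lt_trans ab.
- move=> x; rewrite in_itv/= => /andP[ax _].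
  by rewrite derive1E; have /@derive_val := D x (lt_trans a0 ax).
Qed.

Lemma integral_powR_itvoc_le r x : -1 < r -> 0 < x ->
  (\int[mu]_(t in `]0%R, x]) (t `^ r)%:E <= (x `^ (r + 1) / (r + 1))%:E)%E.
Proof.
move=> r1 x0; have r10 : 0 < r + 1 by lra.
(* Monotone convergence along intervals that avoid the singularity at 0. The shift [n.+2] keeps the
   left endpoint strictly below x even for n = 0, as [integral_powR_itvcc] requires. *)
pose F (n : nat) : set R := `[x / n.+2%:R, x]%classic.
have UF : \bigcup_i F i = `]0, x]%classic.
  apply/seteqP; split => t /=.
    move=> [n _]; rewrite /F/= !in_itv/= => /andP[nt ->]; rewrite andbT.
    by apply: lt_le_trans nt; rewrite divr_gt0.
  rewrite in_itv/= => /andP[t0 tx]; exists (Num.truncn (x / t)) => //.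
  rewrite /F/= in_itv/= tx andbT ler_pdivrMr// mulrC -ler_pdivrMr//.
  apply/ltW/(lt_le_trans (truncnS_gt _)); by rewrite ler_nat.
have := @ge0_nondecreasing_set_cvg_integral _ (measurableTypeR R) R F (fun t => (t `^ r)%:E) mu.
rewrite UF => c.
have {}c : (\int[mu]_(t in F n) (t `^ r)%:E)%E @[n --> \oo] -->
   (\int[mu]_(t in `]0%R, x]) (t `^ r)%:E)%E.
  apply: c.
  - apply/nondecreasing_seqP => n; apply/subsetPset => t; rewrite /F/= !in_itv/=.
    move=> /andP[h ->]; rewrite andbT; apply: le_trans h.
    by rewrite ler_pM2l// lef_pV2 ?posrE// ler_nat.
  - by move=> n; exact: measurable_itv.
  - by move=> n; apply/measurable_EFinP/measurable_funTS; exact: measurable_powR.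
  - by move=> n t _; rewrite lee_fin powR_ge0.
rewrite -(cvg_lim _ c)//; apply: lime_le; first exact: cvgP c.
apply: nearW => n; rewrite integral_powR_itvcc ?gt_eqF ?divr_gt0//.
  by rewrite lee_fin ler_pM2r ?invr_gt0// gerBl powR_ge0.
by rewrite ltr_pdivrMr// ltr_pMr// ltr1n.
Qed.

End powR_integral.

Section weighted_hoelder.
Context {R : realType}.
Local Notation mu := (@lebesgue_measure R).
Variables (p q : R).
Hypotheses (p0 : 0 < p) (q0 : 0 < q) (pq : p^-1 + q^-1 = 1).

(** Hölder for the product of t^a g and t^(-a); a q < 1 makes t^(-a q) integrable at 0. The weight a
    = 0 yields the growth of primitives, and a positive weight yields Hardy's inequality. *)
Lemma weighted_hoelder (g : R -> R) (a x : R) :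
  measurable_fun setT g -> (forall t, 0 <= g t) -> a * q < 1 -> 0 < x ->
  (\int[mu]_(t in `]0%R, x]) (g t)%:E <=
   ((x `^ (1 - a * q) / (1 - a * q)) `^ q^-1)%:E *
   (\int[mu]_(t in `]0%R, x]) (t `^ (a * p) * (g t) `^ p)%:E) `^ p^-1)%E.
Proof.
move=> mg g0 aq x0; have mI : measurable (`]0, x] : set R) by exact: measurable_itv.
pose f1 := (fun t => t `^ a * g t) \_ `]0, x].
pose f2 := (fun t : R => t `^ (- a)) \_ `]0, x].
have mf1 : measurable_fun setT f1.
  apply/(measurable_restrictT _ mI); apply: measurable_funTS.
  by apply: measurable_funM => //; exact: measurable_powR.
have mf2 : measurable_fun setT f2.
  by apply/(measurable_restrictT _ mI); apply: measurable_funTS; exact: measurable_powR.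
have I1 : (\int[mu]_(t in `]0%R, x]) (g t)%:E = 'N[mu]_1[EFin \o (f1 \* f2)%R])%E.
  rewrite Lnorm1 [in LHS]integral_mkcond; apply: eq_integral => t _.
  rewrite /f1 /f2 /= !patchE; case: ifPn => [|_]; last by rewrite mul0r normr0.
  rewrite inE/= in_itv/= => /andP[t0 _].
  by rewrite mulrAC -powRD_gt0// subrr powRr0 mul1r ger0_norm.
have I2 : ('N[mu]_p%:E[EFin \o f1] =
    (\int[mu]_(t in `]0%R, x]) (t `^ (a * p) * (g t) `^ p)%:E) `^ p^-1)%E.
  rewrite unlock /Lnorm [in RHS]integral_mkcond; congr (_ `^ _)%E.
  apply: eq_integral => t _; rewrite /f1 /= !patchE.
  case: ifPn => _ /=; last by rewrite normr0 powR0 ?gt_eqF.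
  by rewrite ger0_norm ?mulr_ge0 ?powR_ge0// powRM ?powR_ge0// powRrM.
have I3 : ('N[mu]_q%:E[EFin \o f2] <= ((x `^ (1 - a * q) / (1 - a * q)) `^ q^-1)%:E)%E.
  rewrite unlock /Lnorm -poweR_EFin; apply: gt0_ler_poweR.
  - by rewrite invr_ge0 ltW.
  - by rewrite in_itv/= leey andbT integral_ge0// => t _; rewrite poweR_ge0.
  - by rewrite in_itv/= leey andbT lee_fin divr_ge0 ?powR_ge0// subr_ge0 ltW.
  rewrite addrC -mulNr; apply: le_trans (integral_powR_itvoc_le _ x0); last lra.
  rewrite [leRHS]integral_mkcond; apply: ge0_le_integral => //.
  - by move=> t _; exact: poweR_ge0.
  - apply/measurable_EFinP; apply: (measurableT_comp (measurable_powR _)) => //.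
    exact: measurableT_comp.
  - apply/(measurable_restrictT _ mI)/measurable_EFinP/measurable_funTS.
    exact: measurable_powR.
  - move=> t _; rewrite /f2 /= !patchE; case: ifPn => _ /=; last by rewrite normr0 powR0 ?gt_eqF.
    by rewrite ger0_norm ?powR_ge0// powRrM.
rewrite I1 -I2 muleC; apply: le_trans (hoelder mu mf1 mf2 p0 q0 pq) _.
by rewrite lee_wpmul2l ?Lnorm_ge0.
Qed.

End weighted_hoelder.

Section hardy.
Context {R : realType}.
Local Notation mu := (@lebesgue_measure R).
Variables (p : R) (p1 : 1 < p).
Local Notation D := (`[0, 1]%classic : set R).
Let mD : measurable D. Proof. exact: measurable_itv. Qed.
Let p0 : 0 < p. Proof. exact: lt_trans p1. Qed.
Let q := (1 - p^-1)^-1.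
Let qV : q^-1 = 1 - p^-1. Proof. by rewrite /q invrK. Qed.
Let qV0 : 0 < q^-1. Proof. by rewrite qV subr_gt0 invf_lt1. Qed.
Let q0 : 0 < q. Proof. by rewrite -invr_gt0. Qed.
Let pq : p^-1 + q^-1 = 1. Proof. by rewrite qV addrC subrK. Qed.

(** Hölder against the constant 1. The exponent 1 - 1/p obtained here is the threshold of the whole
    argument. *)
Lemma cLfun_int_le (h : R -> R[i]) x : h \in cLfun mu D p -> 0 < x <= 1 ->
  (\int[mu]_(t in `]0%R, x]) (cmod D h t)%:E <=
   (x `^ (1 - p^-1))%:E * 'N[mu]_p%:E[EFin \o cmod D h])%E.
Proof.
move=> hL /andP[x0 x1]; have /(cLfun_integralP _ _ (ltW p1))[hr hi hfin] := hL.
have mg := measurable_cmod mD hr hi.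
have := weighted_hoelder p0 q0 pq mg (cmod_ge0 D h) (a := 0) _ x0.
rewrite !mul0r ltr01 subr0 powRr1 ?(ltW x0)// divr1 qV => /(_ isT) /le_trans; apply.
rewrite lee_wpmul2l ?lee_fin ?powR_ge0// Lnorm_cmodE ?(ltW p1)//.
apply: gt0_ler_poweR.
- by rewrite invr_ge0 ltW.
- rewrite in_itv/= leey andbT integral_ge0// => t _.
  by rewrite lee_fin mulr_ge0 ?powR_ge0.
- rewrite in_itv/= leey andbT integral_ge0// => t _.
  by rewrite lee_fin powR_ge0.
have sub : `]0, x] `<=` D.
  move=> t; rewrite /= !in_itv/= => /andP[t0 tx]; rewrite (ltW t0)/=.
  exact: le_trans x1.
rewrite [leLHS](_ : _ = \int[mu]_(t in `]0%R, x]) (Normc.normc (h t) `^ p)%:E)%E; last first.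
  apply: eq_integral => t /set_mem It; rewrite powRr0 mul1r /cmod patchE mem_set//.
  exact: sub It.
apply: ge0_subset_integral => //.
  exact: measurable_normc_powR.
by move=> t _; rewrite lee_fin powR_ge0.
Qed.

Lemma cLfun_int_fin (h : R -> R[i]) : h \in cLfun mu D p ->
  mu.-integrable D (EFin \o (@complex.Re R \o h)) /\
  mu.-integrable D (EFin \o (@complex.Im R \o h)).
Proof.
move=> hL; have /(cLfun_integralP _ _ (ltW p1))[hr hi hfin] := hL.
have fin : (\int[mu]_(t in D) (Normc.normc (h t))%:E < +oo)%E.
  rewrite -integral_itv_obnd_cbnd; last first.
    apply/measurable_EFinP; apply: measurable_funS (measurable_normc mD hr hi) => //.
    by apply: subset_itvr; rewrite bnd_simp.
  have := @cLfun_int_le h 1 hL; rewrite ltr01 lexx => /(_ isT).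
  rewrite powR1 mul1e => hh.
  rewrite [ltLHS](_ : _ = \int[mu]_(t in `]0%R, 1%R]) (cmod D h t)%:E)%E.
    apply: le_lt_trans hh _; by have /cLfunP[] := hL.
  apply: eq_integral => t; rewrite inE/= in_itv/= => /andP[t0 t1].
  by rewrite /cmod patchE mem_set//= in_itv/= t1 ltW.
split; apply/integrableP; split => //; try exact/measurable_EFinP;
  apply: le_lt_trans fin; apply: ge0_le_integral => //=.
- by apply/measurable_EFinP; exact: measurableT_comp.
- by apply/measurable_EFinP; exact: measurable_normc.
- by move=> t _; rewrite lee_fin normc_ge_Re.
- by apply/measurable_EFinP; exact: measurableT_comp.
- by apply/measurable_EFinP; exact: measurable_normc.
- by move=> t _; rewrite lee_fin normc_ge_Im.
Qed.

Lemma cLfun_integrable_le (h : R -> R[i]) x : h \in cLfun mu D p -> 0 <= x <= 1 ->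
  mu.-integrable `[0, x] (EFin \o (@complex.Re R \o h)) /\
  mu.-integrable `[0, x] (EFin \o (@complex.Im R \o h)).
Proof.
move=> hL /andP[x0 x1]; have [hr hi] := cLfun_int_fin hL.
have sub : `[0, x] `<=` D by apply: subset_itvl; rewrite bnd_simp.
by split; apply: (@integrableS _ (measurableTypeR R) R mu D) => //;
  exact: measurable_itv.
Qed.

Lemma normr_cintegral_le (h : R -> R[i]) x : h \in cLfun mu D p -> 0 < x <= 1 ->
  (`|complex.Re (cintegral `[0%R, x] h)|%:E <= \int[mu]_(t in `]0%R, x]) (cmod D h t)%:E)%E /\
  (`|complex.Im (cintegral `[0%R, x] h)|%:E <= \int[mu]_(t in `]0%R, x]) (cmod D h t)%:E)%E.
Proof.
move=> hL x01; have /andP[x0 x1] := x01.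
have /(cLfun_integralP _ _ (ltW p1))[hr hi hfin] := hL.
have mg := measurable_cmod mD hr hi.
have [ir ii] := @cLfun_integrable_le h x hL (introT andP (conj (ltW x0) x1)).
have mI : measurable (`[0, x] : set R) by exact: measurable_itv.
have sub : `[0, x] `<=` D by apply: subset_itvl; rewrite bnd_simp.
have hrx := measurable_funS mD sub hr; have hix := measurable_funS mD sub hi.
have mgI : measurable_fun `]0, x] (fun t => (cmod D h t)%:E).
  by apply/measurable_EFinP; exact: measurable_funTS.
split; rewrite /cintegral /= EFin_normr_Rintegral//.
  apply: le_trans (le_abse_integral _ _ _) _ => //; first by case/integrableP : ir.
  rewrite integral_itv_obnd_cbnd//; apply: ge0_le_integral => //=.
  - by apply/measurable_EFinP; exact: measurableT_comp hrx.
  - by apply/measurable_EFinP; exact: measurable_funTS.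
  - move=> t tx; have Dt := sub _ tx; rewrite lee_fin /cmod patchE mem_set//=; exact: normc_ge_Re.
apply: le_trans (le_abse_integral _ _ _) _ => //; first by case/integrableP : ii.
rewrite integral_itv_obnd_cbnd//; apply: ge0_le_integral => //=.
- by apply/measurable_EFinP; exact: measurableT_comp hix.
- by apply/measurable_EFinP; exact: measurable_funTS.
- move=> t tx; have Dt := sub _ tx; rewrite lee_fin /cmod patchE mem_set//=; exact: normc_ge_Im.
Qed.

End hardy.

Section hardy_tonelli.
Context {R : realType}.
Local Notation mu := (@lebesgue_measure R).
Variables (s : R) (s0 : 0 < s).

(** Tonelli on the triangle t <= x: the integral of x^(-1-s) over [t, 1] is (t^(-s) - 1) / s <=
    t^(-s) / s, and the weight t^s cancels the power of t. Measurability of the outer integrand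
    comes with the same theorem. *)
Lemma hardy_tonelli (g : R -> R) : measurable_fun setT g -> (forall t, 0 <= g t) ->
  measurable_fun (`]0, 1]%classic : set R) (fun x => (x `^ (- (1 + s)))%:E *
    \int[mu]_(t in `]0%R, x]) (t `^ s * g t)%:E)%E /\
  (\int[mu]_(x in `]0%R, 1%R])
     ((x `^ (- (1 + s)))%:E * \int[mu]_(t in `]0%R, x]) (t `^ s * g t)%:E)
   <= (s^-1)%:E * \int[mu]_(t in `]0%R, 1%R]) (g t)%:E)%E.
Proof.
move=> mg g0.
have mI (x : R) : measurable (`]0, x] : set (measurableTypeR R)) by exact: measurable_itv.
pose phi : measurableTypeR R -> R := (fun x => x `^ (- (1 + s))) \_ `]0, 1].
pose psi : measurableTypeR R -> R := (fun t => t `^ s * g t) \_ `]0, 1].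
have mphi : measurable_fun setT phi.
  by apply/(measurable_restrictT _ (mI 1)); apply: measurable_funTS; exact: measurable_powR.
have mpsi : measurable_fun setT psi.
  apply/(measurable_restrictT _ (mI 1)); apply: measurable_funTS.
  by apply: measurable_funM => //; exact: measurable_powR.
have phi0 x : 0 <= phi x by rewrite /phi patchE; case: ifP => // _; exact: powR_ge0.
have psi0 x : 0 <= psi x.
  by rewrite /psi patchE; case: ifP => // _; rewrite mulr_ge0// powR_ge0.
pose F (z : measurableTypeR R * measurableTypeR R) : R :=
  if z.2 <= z.1 then phi z.1 * psi z.2 else 0.
have mF : measurable_fun setT (EFin \o F).
  apply/measurable_EFinP; apply: measurable_fun_ifT.
  - by apply: measurable_fun_ler; [exact: measurable_snd|exact: measurable_fst].
  - by apply: measurable_funM; [apply: measurableT_comp mphi _; exact: measurable_fst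
                               |apply: measurableT_comp mpsi _; exact: measurable_snd].
  - exact: measurable_cst.
have F0 z : (0%R <= (EFin \o F) z)%E.
  by rewrite lee_fin /F; case: ifP => // _; rewrite mulr_ge0.
pose G x := ((x `^ (- (1 + s)))%:E *
  \int[mu]_(t in `]0%R, x]) (t `^ s * g t)%:E)%E.
have GE : G \_ `]0, 1] = (fun x => \int[mu]_t (EFin \o F) (x, t))%E.
  apply/funext => x; rewrite patchE /G.
  case: ifPn => [|xI].
    move=> /[dup] xI; rewrite inE/= in_itv/= => /andP[x0 x1].
    rewrite -ge0_integralZl//; last 3 first.
    - apply/measurable_EFinP/measurable_funTS.
      by apply: measurable_funM => //; exact: measurable_powR.
    - by move=> t _; rewrite lee_fin mulr_ge0 ?powR_ge0.
    - by rewrite lee_fin powR_ge0.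
    rewrite [in LHS]integral_mkcond; apply: eq_integral => t _.
    rewrite patchE /F /= /phi /psi !patchE xI.
    case: ifPn => [|tI].
      rewrite inE/= in_itv/= => /andP[t0 tx]; rewrite tx mem_set//=.
      by rewrite in_itv/= t0 (le_trans tx).
    case: ifPn => // tx; case: ifPn => [|_]; last by rewrite mulr0.
    rewrite inE/= in_itv/= => /andP[t0 t1]; move: tI.
    by rewrite notin_setE/= in_itv/= t0 tx.
  rewrite integral0_eq// => t _; rewrite /= /F /= /phi patchE (negbTE xI) mul0r.
  by case: ifP.
have E2 : (\int[mu]_t \int[mu]_x (EFin \o F) (x, t) <=
   (s^-1)%:E * \int[mu]_(t in `]0%R, 1%R]) (g t)%:E)%E.
  rewrite -ge0_integralZl//; last 3 first.
  - by apply/measurable_EFinP/measurable_funTS.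
  - by move=> t _; rewrite lee_fin.
  - by rewrite lee_fin invr_ge0 ltW.
  rewrite [leRHS]integral_mkcond; apply: ge0_le_integral => //.
  - by move=> t _; exact: integral_ge0.
  - by have := measurable_fun_fubini_tonelli_G (m1 := mu) (EFin \o F) mF F0.
  - apply/(measurable_restrictT _ (mI 1)); apply: measurable_funTS.
    by apply: emeasurable_funM => //; exact/measurable_EFinP.
  - move=> t _; rewrite patchE; case: ifPn => [|tI]; last first.
      rewrite integral0_eq// => x _; rewrite /= /F /= /psi patchE (negbTE tI) mulr0.
      by case: ifP.
    move=> /[dup] tI; rewrite inE/= in_itv/= => /andP[t0 t1].
    have -> : (\int[mu]_x (F (x, t))%:E =
       (t `^ s * g t)%:E * \int[mu]_(x in `[t, 1%R]) (x `^ (- (1 + s)))%:E)%E.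
      rewrite -ge0_integralZl//; last 3 first.
      - by apply/measurable_EFinP/measurable_funTS; exact: measurable_powR.
      - by move=> x _; rewrite lee_fin powR_ge0.
      - by rewrite lee_fin mulr_ge0 ?powR_ge0.
      rewrite [in RHS]integral_mkcond; apply: eq_integral => x _.
      rewrite patchE /F /= /phi /psi !patchE tI; apply/esym.
      case: ifPn => [|xI].
        rewrite inE/= in_itv/= => /andP[tx x1]; rewrite tx mem_set//=.
          by rewrite -EFinM mulrC.
        by rewrite in_itv/= x1 (lt_le_trans t0).
      case: ifPn => // tx; case: ifPn => [|_]; last by rewrite mul0r.
      rewrite inE/= in_itv/= => /andP[x0 x1]; move: xI.
      by rewrite notin_setE/= in_itv/= x1 tx.
    (* At t = 1 the interval [t, 1] is a point, a case that the formula for nondegenerate intervals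
       leaves out. *)
    move: t1; rewrite le_eqVlt => /predU1P[->|t1].
      by rewrite set_itv1 integral_set1 mule0 -EFinM lee_fin mulr_ge0// invr_ge0 ltW.
    have sE : - (1 + s) + 1 = - s by ring.
    rewrite integral_powR_itvcc ?sE ?oppr_eq0 ?gt_eqF// -!EFinM lee_fin powR1.
    have uv : t `^ s * t `^ (- s) = 1.
      by rewrite -powRD_gt0// subrr powRr0.
    have -> : t `^ s * g t * ((1 - t `^ (- s)) / - s) =
        s^-1 * g t * (t `^ s * t `^ (- s) - t `^ s) by field; rewrite gt_eqF.
    by rewrite uv ler_piMr ?mulr_ge0 ?invr_ge0 ?(ltW s0)// gerBl powR_ge0.
split.
  apply/(measurable_restrictT _ (mI 1)); rewrite -/G GE.
  by have := measurable_fun_fubini_tonelli_F (m2 := mu) (EFin \o F) mF F0.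
rewrite [leLHS]integral_mkcond -/G GE.
by rewrite (fubini_tonelli (EFin \o F) mF F0).
Qed.

End hardy_tonelli.

(** For s = 1 - 1/p one has s p = p - 1, so the exponent - p + s s p equals - (1 + s), the weight in
    [hardy_tonelli]. *)
Lemma hardy_exponent {R : realType} (p x s : R) : 0 < x -> 0 < s ->
  (2 * x^-1 * (x `^ s / s) `^ s) `^ p =
  2 `^ p * s `^ (- (s * p)) * x `^ (- p + s * s * p).
Proof.
move=> x0 s0.
have [x_ge0 s_ge0] : 0 <= x /\ 0 <= s by rewrite !ltW.
have xV0 : 0 <= x^-1 by rewrite invr_ge0.
have sV0 : 0 <= s^-1 by rewrite invr_ge0.
have M (a b r : R) : 0 <= a -> 0 <= b -> (a * b) `^ r = a `^ r * b `^ r.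
  exact: powRM.
rewrite (M _ _ _ (mulr_ge0 (ler0n R 2) xV0) (powR_ge0 _ _)) (M _ _ _ (ler0n R 2) xV0).
rewrite (M _ _ _ (powR_ge0 _ _) sV0) (M _ _ _ (powR_ge0 _ _) (powR_ge0 _ _)).
have V (a r : R) : 0 <= a -> a^-1 `^ r = a `^ (- r).
  by move=> a0; rewrite -powR_inv1// -powRrM mulN1r.
have -> : ((x `^ s) `^ s) `^ p = x `^ (s * s * p) by rewrite -!powRrM mulrA.
have -> : (s^-1 `^ s) `^ p = s `^ (- (s * p)) by rewrite (V _ _ s_ge0) -powRrM mulNr.
rewrite (V _ _ x_ge0) (powRD_gt0 _ _ x0).
by move: (x `^ (s * s * p)) (x `^ - p) (s `^ _) (2 `^ p) => a b c e; ring.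
Qed.

(** * Hardy's inequality for the Cesàro operator and its action on classes *)

Section cesaro.
Context {R : realType}.
Local Notation mu := (@lebesgue_measure R).
Variables (p : R) (p1 : 1 < p).
Local Notation D := (`[0, 1]%classic : set R).
Let mD : measurable D. Proof. exact: measurable_itv. Qed.
Let p0 : 0 < p. Proof. exact: lt_trans p1. Qed.
Let s := 1 - p^-1.
Let s0 : 0 < s. Proof. by rewrite subr_gt0 invf_lt1. Qed.

Lemma cesaro_funE (h : R -> R[i]) x :
  cesaro_fun h x = complex.Complex (x^-1 * complex.Re (cintegral `[0, x] h))
                                   (x^-1 * complex.Im (cintegral `[0, x] h)).
Proof. by rewrite /cesaro_fun /=; congr complex.Complex; ring. Qed.

Lemma measurable_cesaro (u : R -> R) : mu.-integrable D (EFin \o u) ->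
  measurable_fun D (fun x => x^-1 * \int[mu]_(t in `[0, x]) u t).
Proof.
move=> iu; apply: measurable_funM.
  apply: (@eq_measurable_fun _ _ _ _ _ (fun x => x `^ (- 1))).
    by move=> x; rewrite inE/= in_itv/= => /andP[x0 _]; rewrite powR_inv1.
  by apply: measurable_funTS; exact: measurable_powR.
have := parameterized_integral_continuous ler01 iu.
exact: subspace_continuous_measurable_fun.
Qed.

(** Weighted Hölder with conjugate exponent q = 1/s and weight a = s/p = 1/(p q), the classical
    choice for Hardy's inequality: then a q = 1/p and 1 - a q = s. The factor 2 comes from
    estimating real and imaginary parts separately. *)
Lemma normc_cesaro_le (h : R -> R[i]) x : h \in cLfun mu D p -> 0 < x <= 1 ->
  ((Normc.normc (cesaro_fun h x) `^ p)%:E <=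
   (2 `^ p * s `^ (- (s * p)))%:E * ((x `^ (- (1 + s)))%:E *
     \int[mu]_(t in `]0%R, x]) (t `^ s * (cmod D h t) `^ p)%:E))%E.
Proof.
move=> hL x01; have /andP[x0 x1] := x01.
have /(cLfun_integralP _ _ (ltW p1))[hr hi hfin] := hL.
have mg := measurable_cmod mD hr hi.
have [bre bim] := normr_cintegral_le p1 hL x01.
set I := (\int[mu]_(t in `]0%R, x]) (cmod D h t)%:E)%E in bre bim.
set W := (\int[mu]_(t in `]0%R, x]) (t `^ s * (cmod D h t) `^ p)%:E)%E.
have W0 : (0 <= W)%E.
  by apply: integral_ge0 => t _; rewrite lee_fin mulr_ge0 ?powR_ge0.
have I0 : (0 <= I)%E.
  by apply: integral_ge0 => t _; rewrite lee_fin cmod_ge0.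
have b1 : ((Normc.normc (cesaro_fun h x))%:E <= (2 * x^-1)%:E * I)%E.
  apply: (@le_trans _ _ (x^-1%:E *
    (`|complex.Re (cintegral `[0%R, x] h)|%:E + `|complex.Im (cintegral `[0%R, x] h)|%:E))%E).
    rewrite -EFinD -EFinM lee_fin cesaro_funE.
    apply: le_trans (normc_le_ReIm _) _; rewrite /= !normrM ger0_norm ?invr_ge0 ?(ltW x0)//.
    by rewrite mulrDr.
  rewrite mulrC EFinM -muleA lee_wpmul2l ?lee_fin ?invr_ge0 ?(ltW x0)//.
  by rewrite mule_natl mule2n leeD.
have q0 : 0 < s^-1 by rewrite invr_gt0.
have pq : p^-1 + s^-1^-1 = 1 by rewrite invrK /s addrC subrK.
have pn0 : p != 0 by rewrite gt_eqF.
have sn0 : s != 0 by rewrite gt_eqF.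
have b2 := weighted_hoelder p0 q0 pq mg (cmod_ge0 D h) (a := s / p) _ x0.
rewrite mulrAC divff// mul1r divfK// invrK -/s -/I -/W in b2.
have {}b2 := b2 (_ : p^-1 < 1).
rewrite invf_lt1// in b2; have {}b2 := b2 p1.
have {}b1 : ((Normc.normc (cesaro_fun h x))%:E <=
    (2 * x^-1 * (x `^ s / s) `^ s)%:E * W `^ p^-1)%E.
  apply: le_trans b1 _; rewrite [in leRHS]EFinM -muleA.
  by rewrite lee_wpmul2l// lee_fin mulr_ge0// invr_ge0 ltW.
rewrite -poweR_EFin.
have r1 : (Normc.normc (cesaro_fun h x))%:E \in `[0%E, +oo%E].
  move: (Normc.normc _) (normc_ge0 (cesaro_fun h x)) => N N0.
  by rewrite in_itv/= leey andbT lee_fin.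
have r2 : ((2 * x^-1 * (x `^ s / s) `^ s)%:E * W `^ p^-1)%E \in `[0%E, +oo%E].
  rewrite in_itv/= leey andbT mule_ge0 ?poweR_ge0// lee_fin.
  by rewrite !mulr_ge0 ?powR_ge0// invr_ge0 ltW.
apply: le_trans (gt0_ler_poweR (ltW p0) r1 r2 b1) _.
rewrite poweRM ?poweR_ge0//; last first.
  by rewrite lee_fin !mulr_ge0 ?powR_ge0// invr_ge0 ltW.
rewrite -poweRrM mulVf// poweRe1// poweR_EFin muleA -EFinM.
rewrite lee_wpmul2r// lee_fin le_eqVlt; apply/orP; left; apply/eqP.
rewrite (hardy_exponent p x0 s0).
by congr (_ * _ `^ _); rewrite /s; field.
Qed.

(** The pointwise bound is integrated with [hardy_tonelli]. This is what rules out the default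
    branch of [insubd] in [cesaro_op]. *)
Lemma cesaro_cLfun (h : R -> R[i]) :
  h \in cLfun mu D p -> cesaro_fun h \in cLfun mu D p.
Proof.
move=> hL; have [ir ii] := cLfun_int_fin p1 hL.
have /(cLfun_integralP _ _ (ltW p1))[hr hi hfin] := hL.
have mg := measurable_cmod mD hr hi.
have mr : measurable_fun D (@complex.Re R \o cesaro_fun h).
  apply: eq_measurable_fun (measurable_cesaro ir) => x _.
  by rewrite /comp cesaro_funE.
have mi : measurable_fun D (@complex.Im R \o cesaro_fun h).
  apply: eq_measurable_fun (measurable_cesaro ii) => x _.
  by rewrite /comp cesaro_funE.
apply/(cLfun_integralP _ _ (ltW p1)); split; [exact: mr|exact: mi|].
rewrite -integral_itv_obnd_cbnd; last first.
  apply: measurable_funS (measurable_normc_powR mD p mr mi) => //.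
  by apply: subset_itvr; rewrite bnd_simp.
set C := (2 `^ p * s `^ (- (s * p))).
have C0 : 0 <= C by rewrite mulr_ge0 ?powR_ge0.
(* The constant is absorbed into the function to which the Tonelli bound is applied. *)
pose g t := C * cmod D h t `^ p.
have mgp : measurable_fun setT g.
  apply: measurable_funM => //.
  by apply: (measurableT_comp (measurable_powR p)).
have g0 t : 0 <= g t by rewrite mulr_ge0 ?powR_ge0.
have [mH leH] := hardy_tonelli s0 mgp g0.
have mI (x : R) : measurable (`]0, x] : set (measurableTypeR R)) by exact: measurable_itv.
apply: (@le_lt_trans _ _ (s^-1%:E * \int[mu]_(t in `]0%R, 1%R]) (g t)%:E)%E).
  apply: le_trans leH; apply: ge0_le_integral => //.
  - by move=> x _; rewrite lee_fin powR_ge0.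
  - apply: measurable_funS (measurable_normc_powR mD p mr mi) => //.
    by apply: subset_itvr; rewrite bnd_simp.
  - move=> x; rewrite /= in_itv/= => x01; apply: le_trans (normc_cesaro_le hL x01) _.
    rewrite -/C muleCA lee_wpmul2l ?lee_fin ?powR_ge0//.
    rewrite -ge0_integralZl//; last 2 first.
    + apply/measurable_EFinP/measurable_funTS; apply: measurable_funM; first exact: measurable_powR.
      by apply: (measurableT_comp (measurable_powR p)).
    + by move=> t _; rewrite lee_fin mulr_ge0 ?powR_ge0.
    rewrite le_eqVlt; apply/orP; left; apply/eqP; apply: eq_integral => t _.
    by rewrite -EFinM mulrCA.
rewrite lte_mul_pinfty ?lee_fin ?invr_ge0 ?(ltW s0)//.
rewrite integral_itv_obnd_cbnd; last exact/measurable_EFinP/measurable_funTS.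
rewrite [ltLHS](_ : _ = C%:E * \int[mu]_(x in D) (Normc.normc (h x) `^ p)%:E)%E.
  by rewrite lte_mul_pinfty.
rewrite -ge0_integralZl; last 4 first.
- exact: mD.
- exact: measurable_normc_powR.
- by move=> t _; rewrite lee_fin powR_ge0.
- by rewrite lee_fin.
apply: eq_integral => t tD; rewrite /g /cmod patchE ifT//.
Qed.


Local Notation Lp_class := (@cLclass _ _ R mu _ (measurable_itv `[0, 1]) p (ltW p1) _).

Lemma cesaro_fun_ae (h k : R -> R[i]) :
  h \in cLfun mu D p -> k \in cLfun mu D p ->
  {ae mu, forall x, D x -> h x = k x} ->
  forall x, D x -> cesaro_fun h x = cesaro_fun k x.
Proof.
move=> hL kL hk x; rewrite /= in_itv/= => x01; have /andP[x0 x1] := x01.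
have [hr hi] := cLfun_integrable_le p1 hL x01.
have [kr ki] := cLfun_integrable_le p1 kL x01.
have sub : `[0, x] `<=` D by apply: subset_itvl; rewrite bnd_simp.
congr (_ * _); congr complex.Complex; rewrite /Rintegral; congr fine.
  apply: ae_eq_integral => //; first by case/integrableP : hr.
    by case/integrableP : kr.
  by move: hk; apply: filterS; [exact: (ae_filter_ringOfSetsType mu)
                                 |move=> t hk /sub /hk /= ->].
apply: ae_eq_integral => //; first by case/integrableP : hi.
  by case/integrableP : ki.
by move: hk; apply: filterS; [exact: (ae_filter_ringOfSetsType mu)
                                 |move=> t hk /sub /hk /= ->].
Qed.

(** From here on [cesaro_op] can be computed on any representative, without [repr] or [insubd]. *)
Lemma cesaro_op_class (h : R -> R[i]) (hL : h \in cLfun mu D p) :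
  cesaro_op p1 (Lp_class hL) = Lp_class (cesaro_cLfun hL).
Proof.
rewrite /cesaro_op; set f := Lp_class hL.
have rL : cLfun_fun (repr f) \in cLfun mu D p by exact: cLfun_funP.
apply/cLspace_eqP; apply: aeW => x Dx.
pose Lf := cLfunType mu (measurable_itv `[0, 1]) (ltW p1).
have -> : cLfun_fun (insubd (0 : Lf) (cesaro_fun (repr f))) =
    cesaro_fun (repr f).
  by apply: (insubdK (sT := Lf)); exact: cesaro_cLfun.
apply: cesaro_fun_ae => //.
by apply/(cLspace_eqP (repr f) (CLfunType _ (ltW p1) hL)); rewrite reprK.
Qed.

End cesaro.

(** * Eigenfunctions of the Cesaro operator *)

(** A function with zero derivative is constant on (0, 1), and the decay at 0 fixes the constant.
    This replaces an initial condition at 0, where the functions to be compared need not be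
    differentiable. *)
Lemma derive0_powR_bound_eq0 {R : realType} (f : R -> R) (C r : R) : 0 < r ->
  (forall x : R, 0 < x < 1 -> is_derive x 1 f 0) ->
  (forall x : R, 0 < x < 1 -> `|f x| <= C * x `^ r) ->
  forall x : R, 0 < x < 1 -> f x = 0.
Proof.
move=> r0 df fC x /andP[x0 x1].
have cst y : 0 < y -> y < x -> f x = f y.
  move=> y0 yx.
  have D z : z \in `[y, x] -> is_derive z 1 f ((fun=> 0) z).
    rewrite in_itv/= => /andP[yz zx]; apply: df.
    by rewrite (lt_le_trans y0)// (le_lt_trans zx).
  have Doo z : z \in `]y, x[ -> is_derive z 1 f ((fun=> 0) z).
    by rewrite in_itv/= => /andP[yz zx]; apply: D; rewrite in_itv/= !ltW.
  have cf : {within `[y, x], continuous f}.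
    by apply: derivable_within_continuous => z zxy; have /@ex_derive := D z zxy.
  have [c _] := MVT yx Doo cf.
  by rewrite mul0r => /subr0_eq.
pose u n : R := x / n.+2%:R.
have u0 n : 0 < u n by rewrite divr_gt0.
have ux n : u n < x by rewrite ltr_pdivrMr// ltr_pMr// ltr1n.
have le n : `|f x| <= C * (u n) `^ r.
  by rewrite (cst (u n))// fC// u0 (lt_trans (ux n)).
have c : C * (u n) `^ r @[n --> \oo] --> C * 0.
  apply: cvgM; first exact: cvg_cst.
  apply: powR_cvg0_seq => // [n|]; first exact/ltW.
  rewrite -(mulr0 x); apply: cvgM; first exact: cvg_cst.
  by have := @cvg_harmonic R; rewrite -(cvg_shiftS (@harmonic R)).
apply/eqP; rewrite -normr_le0 -(mulr0 C) -(cvg_lim _ c)//.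
by apply: limr_ge; [exact: cvgP c|exact: nearW].
Qed.

Lemma ae_neq {R : realType} (r : R) : {ae @lebesgue_measure R, forall x : R, x != r}.
Proof.
exists [set r]; split; [exact: measurable_set1|exact: lebesgue_measure_set1|].
by move=> x /= /negP; rewrite negbK => /eqP.
Qed.

Section primitives.
Context {R : realType}.
Local Notation mu := (@lebesgue_measure R).
Variables (p : R) (p1 : 1 < p).
Local Notation D := (`[0, 1]%classic : set R).
Let mD : measurable D. Proof. exact: measurable_itv. Qed.
Let p0 : 0 < p. Proof. exact: lt_trans p1. Qed.
Let s := 1 - p^-1.
Let s0 : 0 < s. Proof. by rewrite subr_gt0 invf_lt1. Qed.

Lemma is_derive_primitive (u : R -> R) (x : R) : mu.-integrable D (EFin \o u) ->
  0 < x < 1 -> {for x, continuous u} ->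
  is_derive x 1 (fun y : R => \int[mu]_(t in `[0, y]) u t) (u x).
Proof.
move=> iu /andP[x0 x1] cu.
have [d e] := @continuous_FTC1_closed R u 0 x 1 x1 iu x0 cu.
by apply: DeriveDef; [exact: d|rewrite -derive1E e].
Qed.

Lemma continuous_primitive (u : R -> R) (x : R) : mu.-integrable D (EFin \o u) ->
  0 < x < 1 -> {for x, continuous (fun y : R => \int[mu]_(t in `[0, y]) u t)}.
Proof.
move=> iu x01; have c := parameterized_integral_continuous ler01 iu.
have /(continuous_within_itvP _ ltr01)[h _ _] := c.
by apply: h; rewrite in_itv.
Qed.

Lemma cintegral_bound (h : R -> R[i]) : h \in cLfun mu D p ->
  exists2 M : R, 0 <= M & forall x : R, 0 < x < 1 ->
    `|complex.Re (cintegral `[0, x] h)| <= M * x `^ s /\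
    `|complex.Im (cintegral `[0, x] h)| <= M * x `^ s.
Proof.
move=> hL; pose M := fine 'N[mu]_p%:E[EFin \o cmod D h].
have ME : 'N[mu]_p%:E[EFin \o cmod D h]%E = M%:E.
  rewrite /M fineK// ge0_fin_numE ?Lnorm_ge0//.
  by have /cLfunP[] := hL.
exists M; first by rewrite -lee_fin -ME Lnorm_ge0.
move=> x /andP[x0 /ltW x1]; have x01 : 0 < x <= 1 by rewrite x0.
have le := cLfun_int_le p1 hL x01.
have [re im] := normr_cintegral_le p1 hL x01.
by split; rewrite -lee_fin mulrC EFinM -ME; [apply: le_trans re _|apply: le_trans im _].
Qed.

(* With H the primitive of h and a = Re nu, the function |H|^2 x^(-2a) has zero
   derivative, and it tends to 0 at 0 because |H| = O(x^(1 - 1/p)). *)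
Lemma cesaro_eigenfunction0 (h : R -> R[i]) (nu : R[i]) : h \in cLfun mu D p ->
  complex.Re nu < 1 - p^-1 ->
  {ae mu, forall x, D x -> h x = nu * cesaro_fun h x} ->
  {ae mu, forall x, D x -> h x = 0}.
Proof.
(* [k] equals h almost everywhere and has the same means, but it is continuous on (0, 1): its
   primitive can be differentiated at every point there. *)
move=> hL nus hE; pose k : R -> R[i] := nu *: cesaro_fun h.
have kL : k \in cLfun mu D p.
  rewrite /k -[_ *: _]addr0; apply: (cLfun_submod_closed mu mD (ltW p1)).2.
    exact: cesaro_cLfun.
  exact: (cLfun_submod_closed mu mD (ltW p1)).1.
have hk := cesaro_fun_ae p1 hL kL hE.
have [hr hi] := cLfun_int_fin p1 hL.
have [kr ki] := cLfun_int_fin p1 kL.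
set a := complex.Re nu in nus *; pose b := complex.Im nu.
pose u x := \int[mu]_(t in `[0, x]) complex.Re (k t).
pose v x := \int[mu]_(t in `[0, x]) complex.Im (k t).
pose uh x := \int[mu]_(t in `[0, x]) complex.Re (h t).
pose vh x := \int[mu]_(t in `[0, x]) complex.Im (h t).
have nuE : nu = complex.Complex a b by rewrite /a /b; case: (nu).
have kreE (x : R) : complex.Re (k x) = a * (x^-1 * uh x) - b * (x^-1 * vh x).
  by rewrite [k x]/(nu * cesaro_fun h x) cesaro_funE nuE.
have kimE (x : R) : complex.Im (k x) = a * (x^-1 * vh x) + b * (x^-1 * uh x).
  by rewrite [k x]/(nu * cesaro_fun h x) cesaro_funE nuE.
have kE (x : R) : 0 < x < 1 -> x^-1 * uh x = x^-1 * u x /\ x^-1 * vh x = x^-1 * v x.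
  move=> /andP[/ltW x0 /ltW x1]; have := hk x.
  by rewrite !cesaro_funE /= in_itv/= x0 x1 => /(_ isT)[].
have cV (x : R) (w : R -> R) : 0 < x -> {for x, continuous w} ->
    {for x, continuous (fun y : R => y^-1 * w y)}.
  by move=> x0 cw; apply: cvgM => //; apply: cvgV; [rewrite gt_eqF|exact: cvg_id].
have cmb (x c e : R) (w z : R -> R) : {for x, continuous w} -> {for x, continuous z} ->
    {for x, continuous (fun y : R => c * w y + e * z y)}.
  by move=> cw cz; apply: cvgD; apply: cvgM => //; exact: cvg_cst.
(* [du] and [dv] are the real form of x H' = nu H with H = u + i v. The terms in b cancel in u u' +
   v v', which is why only Re nu matters. *)
have du (x : R) : 0 < x < 1 -> is_derive x 1 u (x^-1 * (a * u x - b * v x)).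
  move=> x01; have [e1 e2] := kE x x01; have /andP[x0 _] := x01.
  apply: (is_derive_eq (is_derive_primitive kr x01 _)).
    rewrite (_ : _ \o k = (fun y => a * (y^-1 * uh y) + (- b) * (y^-1 * vh y))).
      by apply: cmb; apply: cV => //; exact: continuous_primitive.
    by apply/funext => y; rewrite /= kreE mulNr.
  by rewrite /= kreE e1 e2; ring.
have dv (x : R) : 0 < x < 1 -> is_derive x 1 v (x^-1 * (a * v x + b * u x)).
  move=> x01; have [e1 e2] := kE x x01; have /andP[x0 _] := x01.
  apply: (is_derive_eq (is_derive_primitive ki x01 _)).
    rewrite (_ : _ \o k = (fun y => a * (y^-1 * vh y) + b * (y^-1 * uh y))).
      by apply: cmb; apply: cV => //; exact: continuous_primitive.
    by apply/funext => y; rewrite /= kimE.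
  by rewrite /= kimE e1 e2; ring.
pose E : R -> R := (u * u + v * v) * (fun x => x `^ (- (2 * a))).
have dE (x : R) : 0 < x < 1 -> is_derive x 1 E 0.
  move=> x01; have /andP[x0 _] := x01.
  have dw := is_derive1_powR (- (2 * a)) x0.
  have du' := du x x01; have dv' := dv x x01.
  have := is_deriveM (is_deriveD (is_deriveM du' du') (is_deriveM dv' dv')) dw.
  move=> /is_derive_eq; apply; rewrite /GRing.scale/=.
  rewrite (powRD_gt0 _ _ x0).
  rewrite powR_inv1 ?(ltW x0)//.
  rewrite -[(u * u + v * v) x]/(u x * u x + v x * v x).
  by move: (x `^ _) => X; field; rewrite gt_eqF.
have [M M0 Mb] := cintegral_bound kL.
have Eb (x : R) : 0 < x < 1 -> `|E x| <= (2 * M ^+ 2) * x `^ (2 * (s - a)).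
  move=> x01; have /andP[x0 _] := x01; have [ub vb] := Mb x x01.
  rewrite -[E x]/((u x * u x + v x * v x) * x `^ (- (2 * a))).
  rewrite ger0_norm; last by rewrite mulr_ge0 ?powR_ge0// addr_ge0// -expr2 sqr_ge0.
  have -> : 2 * (s - a) = s + s + - (2 * a) by ring.
  rewrite (powRD_gt0 (s + s) _ x0) (powRD_gt0 s _ x0).
  rewrite mulrA ler_wpM2r ?powR_ge0//.
  have sq (y : R) : `|y| <= M * x `^ s -> y * y <= M ^+ 2 * (x `^ s * x `^ s).
    move=> yM; rewrite -expr2 -real_normK ?num_real//.
    rewrite -expr2 -exprMn ler_pXn2r// nnegrE ?mulr_ge0 ?powR_ge0//.
  have hu : u x * u x <= M ^+ 2 * (x `^ s * x `^ s) := sq _ ub.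
  have hv : v x * v x <= M ^+ 2 * (x `^ s * x `^ s) := sq _ vb.
  by apply: le_trans (lerD hu hv) _; rewrite le_eqVlt; apply/orP; left; apply/eqP; ring.
have E0 := derive0_powR_bound_eq0 (_ : 0 < 2 * (s - a)) dE Eb.
have uv0 (x : R) : 0 < x < 1 -> u x = 0 /\ v x = 0.
  move=> x01; have /andP[x0 _] := x01.
  have := E0 _ x x01; rewrite mulr_gt0 ?subr_gt0// => /(_ isT) /eqP.
  rewrite -[E x]/((u x * u x + v x * v x) * x `^ (- (2 * a))).
  rewrite mulf_eq0 [X in _ || X]gt_eqF ?powR_gt0// orbF.
  rewrite paddr_eq0 -?expr2 ?sqr_ge0// !sqrf_eq0 => /andP[/eqP ? /eqP ?].
  by split.
move: hE (ae_neq (0 : R)) (ae_neq (1 : R)).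
apply: (@filterS3 _ _ (ae_filter_ringOfSetsType mu)).
move=> x hx x0 x1 Dx; rewrite hx//.
have x01 : 0 < x < 1.
  by move: Dx; rewrite /= in_itv/= !lt_neqAle [0 == x]eq_sym x0 x1.
have [e1 e2] := kE x x01; have [u0 v0] := uv0 x x01.
by rewrite cesaro_funE -[complex.Re _]/(uh x) -[complex.Im _]/(vh x) e1 e2 u0 v0 mulr0 mulr0.
Qed.

End primitives.

Lemma near_continuous {R : realType} (f g : R -> R) (x : R) :
  (\forall y \near x, g y = f y) -> {for x, continuous g} -> {for x, continuous f}.
Proof.
move=> gf cg; rewrite /prop_for /continuous_at -(nbhs_singleton gf).
by apply: cvg_trans cg; exact: near_eq_cvg.
Qed.

(** * Complex powers as eigenfunctions *)

Section cpowR.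
Context {R : realType}.
Local Notation mu := (@lebesgue_measure R).
Local Notation D := (`[0, 1]%classic : set R).
Let mD : measurable D. Proof. exact: measurable_itv. Qed.
Implicit Types (w : R[i]) (x : R).

(* x^(w-1) *)
Definition mon w x : R[i] :=
  if 0 < x then
    complex.Complex (x `^ (complex.Re w - 1) * cos (complex.Im w * ln x))
                    (x `^ (complex.Re w - 1) * sin (complex.Im w * ln x))
  else 0.

Lemma mon0 w : mon w 0 = 0. Proof. by rewrite /mon ltxx. Qed.

Lemma normc_mon w x : 0 < x -> Normc.normc (mon w x) = x `^ (complex.Re w - 1).
Proof.
move=> x0; rewrite /mon x0 /= !exprMn -mulrDr cos2Dsin2 mulr1 sqrtr_sqr.
by rewrite ger0_norm ?powR_ge0.
Qed.

Lemma monD w (t : R) x : 0 < x -> mon (w + t%:C%C) x = mon w x * (x `^ t)%:C%C.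
Proof.
move=> x0; rewrite /mon x0; case: w => a b /=; rewrite addr0.
rewrite addrAC (powRD_gt0 (a - 1) t x0).
by congr complex.Complex; ring.
Qed.

(** The index on the right is 2 - w, because (w - 1) + ((2 - w) - 1) = 0. *)
Lemma mon_inv w x : 0 < x ->
  mon w x * mon (complex.Complex (2 - complex.Re w) (- complex.Im w)) x = 1.
Proof.
move=> x0; rewrite /mon x0; case: w => a b /=; rewrite mulNr cosN sinN.
have e : x `^ (a - 1) * x `^ (2 - a - 1) = 1.
  rewrite -powRD_gt0//.
  by rewrite [_ + _](_ : _ = 0) ?powRr0//; ring.
have t := cos2Dsin2 (b * ln x).
move: (x `^ _) (x `^ _) (cos _) (sin _) e t => y z c d e t.
congr complex.Complex.
  by transitivity ((z * y) * (c ^+ 2 + d ^+ 2)); [ring|rewrite e t mulr1].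
by ring.
Qed.

Lemma measurable_mon w :
  measurable_fun setT (@complex.Re R \o mon w) /\
  measurable_fun setT (@complex.Im R \o mon w).
Proof.
have mt (f : R -> R) : measurable_fun setT f ->
    measurable_fun setT (fun x => if 0 < x then
      x `^ (complex.Re w - 1) * f (complex.Im w * ln x) else 0).
  move=> mf; apply: measurable_fun_ifT => //.
    exact: measurable_fun_ltr.
  apply: measurable_funM; first exact: measurable_powR.
  apply: (measurableT_comp mf); apply: measurable_funM => //; exact: measurable_ln.
split.
  rewrite (_ : _ \o _ = fun x => if 0 < x then
    x `^ (complex.Re w - 1) * cos (complex.Im w * ln x) else 0).
    by apply: mt; apply: continuous_measurable_fun; exact: continuous_cos.
  by apply/funext => x; rewrite /= /mon; case: ifP.
rewrite (_ : _ \o _ = fun x => if 0 < x then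
  x `^ (complex.Re w - 1) * sin (complex.Im w * ln x) else 0).
  by apply: mt; apply: continuous_measurable_fun; exact: continuous_sin.
by apply/funext => x; rewrite /= /mon; case: ifP.
Qed.

Variables (p : R) (p1 : 1 < p).
Let p0 : 0 < p. Proof. exact: lt_trans p1. Qed.
Let s := 1 - p^-1.
Let s0 : 0 < s. Proof. by rewrite subr_gt0 invf_lt1. Qed.

Lemma mon_cLfun w : 1 - p^-1 < complex.Re w -> mon w \in cLfun mu D p.
Proof.
move=> sw; have [mr mi] := measurable_mon w.
have mr' : measurable_fun D (@complex.Re R \o mon w) by exact: measurable_funTS.
have mi' : measurable_fun D (@complex.Im R \o mon w) by exact: measurable_funTS.
apply/(cLfun_integralP _ _ (ltW p1)); split; [exact: mr'|exact: mi'|].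
rewrite -integral_itv_obnd_cbnd; last first.
  apply: measurable_funS (measurable_normc_powR mD p mr' mi') => //.
  by apply: subset_itvr; rewrite bnd_simp.
set a := complex.Re w in sw.
rewrite [ltLHS](_ : _ = \int[mu]_(x in `]0%R, 1%R]) (x `^ ((a - 1) * p))%:E)%E.
  apply: le_lt_trans (integral_powR_itvoc_le _ ltr01) (ltry _).
  rewrite -[ltLHS]mulN1r -ltr_pdivrMr//.
  by rewrite mulN1r -/s; move: sw; rewrite /s; lra.
apply: eq_integral => x; rewrite inE/= in_itv/= => /andP[x0 _].
by rewrite normc_mon// powRrM.
Qed.

(** The integrand may be unbounded at 0, so the primitive is not evaluated between endpoints.
    Instead w times the primitive of x^(w-1), minus x^w, has zero derivative on (0, 1) and is
    O(x^s), hence vanishes. *)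
Lemma cesaro_mon w x : 1 - p^-1 < complex.Re w -> 0 < x < 1 ->
  w * cesaro_fun (mon w) x = mon w x.
Proof.
move=> sw x01; have mL := mon_cLfun sw.
have [ir ii] := cLfun_int_fin p1 mL.
have [M M0 Mb] := cintegral_bound p1 mL.
case: w => a b /= in sw mL ir ii Mb *.
set m := mon _ in mL ir ii Mb *.
pose u (x : R) := \int[mu]_(t in `[0, x]) complex.Re (m t).
pose v (x : R) := \int[mu]_(t in `[0, x]) complex.Im (m t).
(* P + i Q is x^w. *)
pose P : R -> R := (fun y => y `^ a) * (cos \o (fun y => b * ln y)).
pose Q : R -> R := (fun y => y `^ a) * (sin \o (fun y => b * ln y)).
have reE (y : R) : 0 < y -> complex.Re (m y) = y `^ (a - 1) * cos (b * ln y).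
  by move=> y0; rewrite /m /mon y0.
have imE (y : R) : 0 < y -> complex.Im (m y) = y `^ (a - 1) * sin (b * ln y).
  by move=> y0; rewrite /m /mon y0.
have dln (y : R) : 0 < y -> is_derive y 1 (fun y => b * ln y) (b * y^-1).
  by move=> y0; have := is_deriveZ b (is_derive1_ln y0).
have dcos (y : R) : 0 < y ->
    is_derive y 1 (cos \o (fun y => b * ln y)) (- sin (b * ln y) * (b * y^-1)).
  move=> y0; exact: (@is_derive1_comp R cos (fun y => b * ln y) y _ _
    (is_derive_cos (b * ln y)) (dln y y0)).
have dsin (y : R) : 0 < y ->
    is_derive y 1 (sin \o (fun y => b * ln y)) (cos (b * ln y) * (b * y^-1)).
  move=> y0; exact: (@is_derive1_comp R sin (fun y => b * ln y) y _ _
    (is_derive_sin (b * ln y)) (dln y y0)).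
have cont (y : R) (f : R -> R) df : is_derive y 1 f df -> {for y, continuous f}.
  by move=> /@ex_derive d; apply/differentiable_continuous/derivable1_diffP.
have cre (y : R) : 0 < y -> {for y, continuous (@complex.Re R \o m)}.
  move=> y0; apply: (@near_continuous _ _ (fun y => y `^ (a - 1) * cos (b * ln y))).
    by near=> z; rewrite /= reE//; near: z; exact: lt_nbhsr.
  apply: cvgM; first exact: continuous_powR_gt0.
  exact: cont (dcos y y0).
have cim (y : R) : 0 < y -> {for y, continuous (@complex.Im R \o m)}.
  move=> y0; apply: (@near_continuous _ _ (fun y => y `^ (a - 1) * sin (b * ln y))).
    by near=> z; rewrite /= imE//; near: z; exact: lt_nbhsr.
  apply: cvgM; first exact: continuous_powR_gt0.
  exact: cont (dsin y y0).
have du (y : R) : 0 < y < 1 -> is_derive y 1 u (complex.Re (m y)).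
  move=> y01; have /andP[y0 _] := y01.
  exact: (is_derive_primitive ir y01 (cre y y0)).
have dv (y : R) : 0 < y < 1 -> is_derive y 1 v (complex.Im (m y)).
  move=> y01; have /andP[y0 _] := y01.
  exact: (is_derive_primitive ii y01 (cim y y0)).
have pE (y : R) : 0 < y -> y `^ a * y^-1 = y `^ (a - 1).
  by move=> y0; rewrite powRD_gt0// powR_inv1// ltW.
have df1 (y : R) : 0 < y < 1 -> is_derive y 1 (a *: u - b *: v - P) 0.
  move=> y01; have /andP[y0 _] := y01.
  have dP := is_deriveM (is_derive1_powR a y0) (dcos y y0).
  have := is_deriveB (is_deriveB (is_deriveZ a (du y y01)) (is_deriveZ b (dv y y01))) dP.
  move=> /is_derive_eq; apply; rewrite /GRing.scale/= reE// imE// -(pE y y0).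
  by ring.
have df2 (y : R) : 0 < y < 1 -> is_derive y 1 (a *: v + b *: u - Q) 0.
  move=> y01; have /andP[y0 _] := y01.
  have dQ := is_deriveM (is_derive1_powR a y0) (dsin y y0).
  have := is_deriveB (is_deriveD (is_deriveZ a (dv y y01)) (is_deriveZ b (du y y01))) dQ.
  move=> /is_derive_eq; apply; rewrite /GRing.scale/= reE// imE// -(pE y y0).
  by ring.
have pw (y t : R) : 0 < y < 1 -> `|t| <= 1 -> `|y `^ a * t| <= y `^ s.
  move=> /andP[y0 /ltW y1] t1; rewrite normrM ger0_norm ?powR_ge0//.
  apply: le_trans (ler_piMr (powR_ge0 _ _) t1) _.
  by rewrite ger_powR ?y0 ?y1// ltW.
have bd (y A B C : R) : 0 < y < 1 -> `|A| <= M * y `^ s -> `|B| <= M * y `^ s ->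
    `|C| <= y `^ s ->
    `|a * A + b * B - C| <= (`|a| * M + `|b| * M + 1) * y `^ s.
  move=> y01 hA hB hC; apply: le_trans (ler_normB _ _) _.
  rewrite 2!mulrDl mul1r lerD//; apply: le_trans (ler_normD _ _) _.
  by rewrite !normrM lerD// -mulrA ler_wpM2l.
have z1 := derive0_powR_bound_eq0 s0 df1 _ x01.
have z2 := derive0_powR_bound_eq0 s0 df2 _ x01.
have /z1 {}z1 (y : R) : 0 < y < 1 ->
    `|(a *: u - b *: v - P) y| <= (`|a| * M + `|b| * M + 1) * y `^ s.
  move=> y01; have [ub vb] := Mb y y01.
  have := bd y (u y) (- v y) (P y) y01 ub; rewrite normrN mulrN; apply => //.
  by apply: pw => //; rewrite ler_norml cos_geN1 cos_le1.
have /z2 {}z2 (y : R) : 0 < y < 1 ->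
    `|(a *: v + b *: u - Q) y| <= (`|a| * M + `|b| * M + 1) * y `^ s.
  move=> y01; have [ub vb] := Mb y y01.
  apply: (bd y (v y) (u y) (Q y)) => //.
  by apply: pw => //; rewrite ler_norml sin_geN1 sin_le1.
have /andP[x0 _] := x01.
have {}z1 : a * u x - b * v x = x `^ a * cos (b * ln x) by exact: subr0_eq z1.
have {}z2 : a * v x + b * u x = x `^ a * sin (b * ln x) by exact: subr0_eq z2.
rewrite cesaro_funE -[complex.Re (cintegral _ _)]/(u x) -[complex.Im (cintegral _ _)]/(v x).
rewrite /m /mon x0 /= -(pE x x0).
congr complex.Complex.
  by transitivity (x^-1 * (a * u x - b * v x)); [ring|rewrite z1; ring].
by transitivity (x^-1 * (a * v x + b * u x)); [ring|rewrite z2; ring].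
Unshelve. all: by end_near. Qed.

End cpowR.

(** * Injectivity of the Cesàro operator *)

Section injectivity.
Context {R : realType}.
Local Notation mu := (@lebesgue_measure R).
Local Notation D := (`[0, 1]%classic : set R).
Let mD : measurable D. Proof. exact: measurable_itv. Qed.

Lemma near_in_itv01 (x : R) : 0 < x < 1 -> \forall y \near x, 0 < y < 1.
Proof.
move=> x01; have : nbhs x (`]0, 1[%classic : set R).
  by apply: open_nbhs_nbhs; split; [exact: interval_open|rewrite /= in_itv].
by apply: filterS => y; rewrite /= in_itv.
Qed.

(** A nonzero value would persist on a ball, which has positive measure. *)
Lemma ae_eq0_continuous (u : R -> R) : (forall x, 0 < x < 1 -> {for x, continuous u}) ->
  {ae mu, forall x, 0 < x < 1 -> u x = 0} -> forall x, 0 < x < 1 -> u x = 0.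
Proof.
move=> cu [N [mN N0 subN]] x x01; apply/eqP; apply: contrapT => /negP ux.
have nx : \forall y \near x, u y != 0.
  exact: (cu x x01 _ (open_nbhs_nbhs (conj (@open_neq R 0) ux))).
have n01 := near_in_itv01 x01.
have /nbhs_ballP[e /= e0 He] : \forall y \near x, N y.
  near=> y; apply: subN => /=; apply/not_implyP; split; first by near: y.
  by apply/eqP; near: y.
have : (mu (ball x e) <= mu N)%E by apply: le_measure; rewrite ?inE//; exact: measurable_ball.
have -> : mu (ball x e) = (e *+ 2)%:E := lebesgue_measure_ball x (ltW e0).
rewrite N0 lee_fin leNgt => /negP; apply.
by rewrite mulrn_wgt0.
Unshelve. all: by end_near. Qed.

(** Lebesgue differentiation: u is almost everywhere the derivative of its primitive, which vanishes
    around each interior point. *)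
Lemma primitive_eq0 (u : R -> R) : mu.-integrable D (EFin \o u) ->
  (forall x, 0 < x < 1 -> \int[mu]_(t in `[0, x]) u t = 0) ->
  {ae mu, forall x, D x -> u x = 0}.
Proof.
move=> iu u0; pose f := u \_ D.
have fi : mu.-integrable setT (EFin \o f).
  have mDR : @measurable _ (measurableTypeR R) D by exact: measurable_itv.
  by move/(integrable_mkcond _ mDR) : iu; rewrite /f restrict_EFin.
have lf : locally_integrable setT f.
  exact: (open_integrable_locally openT).
have := @FTC1 R f (BLeft 0) _ lf.
have h (y : R) : mu.-integrable [set` Interval (BLeft 0) (BRight y)] (EFin \o f).
  by apply: (@integrableS _ (measurableTypeR R) R mu setT) => //; exact: measurable_itv.
move=> /(_ h) F; move: F (ae_neq (0 : R)) (ae_neq (1 : R)).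
apply: (@filterS3 _ _ (ae_filter_ringOfSetsType mu)) => x F x0 x1 Dx.
have x01 : 0 < x < 1.
  by move: Dx; rewrite /= in_itv/= !lt_neqAle [0 == x]eq_sym x0 x1.
have /andP[x_gt0 x_lt1] := x01.
have [_] := F x_gt0.
rewrite /f patchE mem_set// => <-; rewrite derive1E.
rewrite (@near_eq_derive _ _ _ _ (cst 0)) ?derive_cst//.
near=> y; have y01 : 0 < y < 1 by near: y; exact: near_in_itv01.
transitivity (\int[mu]_(t in `[0, y]) u t); last exact: u0.
apply: eq_Rintegral => t; rewrite inE/= in_itv/= => /andP[t0 ty].
by rewrite patchE mem_set//= in_itv/= t0 (le_trans ty)//; case/andP: y01 => _ /ltW.
Unshelve. all: by end_near. Qed.

Variables (p : R) (p1 : 1 < p).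

(** Continuity of the primitives turns their vanishing almost everywhere into vanishing on all of
    (0, 1), so that they can be differentiated. *)
Lemma cesaro_fun_eq0 (h : R -> R[i]) : h \in cLfun mu D p ->
  {ae mu, forall x, D x -> cesaro_fun h x = 0} ->
  {ae mu, forall x, D x -> h x = 0}.
Proof.
move=> hL Ch; have [hr hi] := cLfun_int_fin p1 hL.
have E (x : R) : 0 < x < 1 -> cesaro_fun h x = 0 ->
    \int[mu]_(t in `[0, x]) complex.Re (h t) = 0 /\
    \int[mu]_(t in `[0, x]) complex.Im (h t) = 0.
  move=> /andP[x0 _]; rewrite cesaro_funE => -[] /eqP + /eqP.
  rewrite !mulf_eq0 invr_eq0 gt_eqF//=; by move=> /eqP ? /eqP.
have D01 (x : R) : 0 < x < 1 -> D x by rewrite /= in_itv/= => /andP[/ltW -> /ltW].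
have re0 : {ae mu, forall x, D x -> complex.Re (h x) = 0}.
  apply: (primitive_eq0 hr) => x x01.
  apply: (ae_eq0_continuous (u := fun y : R => \int[mu]_(t in `[0, y]) complex.Re (h t))) x01.
    by move=> y y01; exact: continuous_primitive.
  move: Ch; apply: filterS; first exact: (ae_filter_ringOfSetsType mu).
  by move=> y Cy y01; have [] := E y y01 (Cy (D01 y y01)).
have im0 : {ae mu, forall x, D x -> complex.Im (h x) = 0}.
  apply: (primitive_eq0 hi) => x x01.
  apply: (ae_eq0_continuous (u := fun y : R => \int[mu]_(t in `[0, y]) complex.Im (h t))) x01.
    by move=> y y01; exact: continuous_primitive.
  move: Ch; apply: filterS; first exact: (ae_filter_ringOfSetsType mu).
  by move=> y Cy y01; have [] := E y y01 (Cy (D01 y y01)).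
move: re0 im0; apply: filterS2; first exact: (ae_filter_ringOfSetsType mu).
move=> x re im Dx; move: (re Dx) (im Dx); case: (h x) => a b /= -> ->.
by [].
Qed.

End injectivity.

(** * Extended eigenvalues *)

Section extended_eigenvalues.
Context {R : realType}.
Local Notation mu := (@lebesgue_measure R).
Local Notation D := (`[0, 1]%classic : set R).
Let mD : measurable D. Proof. exact: measurable_itv. Qed.
Variables (p : R) (p1 : 1 < p).
Local Notation E := (Lp01 (ltW p1)).
Local Notation Lp_class hL :=
  (@cLclass _ _ R mu _ (measurable_itv `[0, 1]) p (ltW p1) _ hL : E).
Let s := 1 - p^-1.

Lemma Lp_classP h k (hL : h \in cLfun mu D p) (kL : k \in cLfun mu D p) :
  Lp_class hL = Lp_class kL <-> {ae mu, forall x, D x -> h x = k x}.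
Proof. exact: cLspace_eqP. Qed.

Lemma Lp_class_repr (f : E) :
  exists h (hL : h \in cLfun mu D p), f = Lp_class hL.
Proof.
exists (repr f), (cLfun_funP (repr f)).
by rewrite -[LHS]reprK; apply/cLspace_eqP; exact: aeW.
Qed.

Lemma Lp_classZ a h k (hL : h \in cLfun mu D p) (kL : k \in cLfun mu D p) :
  Lp_class kL = a *: Lp_class hL <-> {ae mu, forall x, D x -> k x = a * h x}.
Proof.
have <- : cLspace_scale a (Lp_class hL) = a *: Lp_class hL by [].
rewrite /cLclass pi_cLspace_scale; exact: cLspace_eqP.
Qed.

Lemma Lp_class_eq0 h (hL : h \in cLfun mu D p) :
  Lp_class hL = 0 <-> {ae mu, forall x, D x -> h x = 0}.
Proof.
rewrite -(scale0r (Lp_class hL)); split=> [/Lp_classZ|h0].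
  by apply: filterS => [|x hx Dx]; [exact: (ae_filter_ringOfSetsType mu)|rewrite hx// mul0r].
apply/Lp_classZ; move: h0; apply: filterS => [|x hx Dx].
  exact: (ae_filter_ringOfSetsType mu).
by rewrite hx// mul0r.
Qed.

Variables (X : {linear E -> E}) (bX : bounded_operator X).
Local Notation K :=
  (@ker_fun _ _ R mu _ (measurable_itv `[0, 1]) p (ltW p1) X).

Lemma ker_mon (lambda w : R[i]) : lambda != 0 ->
  (forall f, cesaro_op p1 (X f) = lambda *: X (cesaro_op p1 f)) ->
  s < complex.Re w -> complex.Re (w / lambda) < s -> K (mon w).
Proof.
move=> l0 TX sw wl; have wL := mon_cLfun p1 sw; exists wL.
have w0 : w != 0.
  apply: contraTneq sw => ->; rewrite -leNgt subr_ge0 invf_le1 ?ltW//.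
  exact: lt_trans p1.
have [h [hL e]] := Lp_class_repr (X (Lp_class wL)).
rewrite -[LHS]/(X (Lp_class wL)) e; apply/Lp_class_eq0.
apply: (cesaro_eigenfunction0 p1 hL wl).
have := TX (Lp_class wL); rewrite (cesaro_op_class p1 wL) e (cesaro_op_class p1 hL).
have -> : Lp_class (cesaro_cLfun p1 wL) = w^-1 *: Lp_class wL.
  apply/Lp_classZ; move: (ae_neq (0 : R)) (ae_neq (1 : R)).
  apply: filterS2; first exact: (ae_filter_ringOfSetsType mu).
  move=> x x0 x1 Dx; rewrite -[in RHS](cesaro_mon p1 sw) ?mulKf//.
  by move: Dx; rewrite /= in_itv/= !lt_neqAle [0 == x]eq_sym x0 x1.
(* The relation C h = (lambda / w) h is inverted to h = (w / lambda) C h, the form to which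
   [cesaro_eigenfunction0] applies. *)
rewrite linearZ/= e scalerA => /Lp_classZ.
apply: filterS; first exact: (ae_filter_ringOfSetsType mu).
by move=> x hx Dx; rewrite hx// -[w / lambda]invf_div mulKf// mulf_neq0// invr_eq0.
Qed.

(** * From a segment of powers to the whole space *)

Section density.
Import HBSimple HBNNSimple.
Variable (w : R[i]) (sw : s < complex.Re w).
Let wL := mon_cLfun p1 sw.

(** It is the product with x^(w-1) that has to be dominated: [h] is a multiple of x^(w-1) for
    bounded sequences, and the target itself when the factors [f_ n] are not uniformly bounded. The
    point 0 is harmless since [mon w 0] is 0. *)
Lemma ker_mon_dominated (f_ : (R -> R)^nat) (f : R -> R) (h : R -> R[i]) :
  h \in cLfun mu D p ->
  (forall n, K (fun x => mon w x * (f_ n x)%:C%C)) ->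
  (forall n x, 0 < x <= 1 -> Normc.normc (mon w x) * `|f_ n x| <= Normc.normc (h x)) ->
  (forall x, 0 < x <= 1 -> f_ n x @[n --> \oo] --> f x) ->
  K (fun x => mon w x * (f x)%:C%C).
Proof.
move=> hL Kf fh f_f; apply: (ker_fun_dct bX Kf hL).
  move=> n x; rewrite /= in_itv/= le_eqVlt => /andP[/predU1P[<- _|x0 x1]].
    by rewrite mon0 mul0r Normc.normc0 normc_ge0.
  by rewrite Normc.normcM normc_real fh// x0.
move=> x; rewrite /= in_itv/= le_eqVlt => /andP[/predU1P[<- _|x0 x1]].
  rewrite mon0; under eq_fun do rewrite !mul0r subr0 Normc.normc0.
  exact: cvg_cst.
under eq_fun do rewrite -mulrBr -rmorphB Normc.normcM normc_real.
suff : Normc.normc (mon w x) * `|f_ n x - f x| @[n --> \oo] -->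
    Normc.normc (mon w x) * 0 by rewrite mulr0.
apply: cvgM; first exact: cvg_cst.
have /cvgrPdist_le c := f_f x (introT andP (conj x0 x1)).
apply/cvgrPdist_le => e e0; have := c e e0; apply: filterS => n.
by rewrite sub0r normrN normr_id distrC.
Qed.

Hypothesis Kw : exists2 d : R, 0 < d & forall t, 0 <= t <= d -> K (mon (w + t%:C%C)).

Lemma ker_mon_nnsfun (F : {nnsfun (measurableTypeR R) >-> R}) :
  K (fun x => mon w x * (F x)%:C%C).
Proof.
pose W (f : R -> R) := K (fun x => mon w x * (f x)%:C%C).
have Wlin (a : R) f g : W f -> W g -> W (fun x => a * f x + g x).
  move=> Wf Wg; have := ker_fun_lin a%:C%C Wf Wg; apply: ker_fun_eq => x _.
  rewrite -[LHS]/(a%:C%C * (mon w x * (f x)%:C%C) + mon w x * (g x)%:C%C).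
  by rewrite rmorphD rmorphM/=; ring.
have Wdct (f_ : (R -> R)^nat) (f : R -> R) (B : R) : (forall n, W (f_ n)) ->
  (forall n (x : R), 0 < x <= 1 -> `|f_ n x| <= B) ->
  (forall x : R, 0 < x <= 1 -> f_ n x @[n --> \oo] --> f x) -> W f.
  move=> Wf fB f_f; apply: (ker_mon_dominated (f_ := f_) (h := B%:C%C *: mon w)) => //.
    rewrite -[_ *: _]addr0; apply: (cLfun_submod_closed mu mD (ltW p1)).2 => //.
    exact: (cLfun_submod_closed mu mD (ltW p1)).1.
  move=> n x x01; rewrite -[(_ *: _) x]/(B%:C%C * mon w x) Normc.normcM normc_real.
  rewrite mulrC ler_wpM2r ?normc_ge0//; apply: le_trans (fB n x x01) (ler_norm _).
have [d d0 Kd] := Kw.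
have Wd t : 0 <= t <= d -> W (fun x => x `^ t).
  move=> td; apply: ker_fun_eq (Kd t td) => x.
  rewrite /= in_itv/= le_eqVlt => /andP[/predU1P[<- _|x0 x1]].
    by rewrite !mon0 mul0r.
  exact: monD.
have Wp := powR_closure Wlin Wdct d0 Wd.
have WA := indic_closure Wlin Wdct Wp.
exact: (nnsfun_closure Wlin WA F).
Qed.

(** Simple functions approximate f from below, so their products with x^(w-1) stay dominated by [h]
    even if f is unbounded. *)
Lemma ker_mon_ge0 (f : R -> R) (h : R -> R[i]) : h \in cLfun mu D p ->
  measurable_fun setT f -> (forall x, 0 <= f x) ->
  (forall x, 0 < x <= 1 -> Normc.normc (mon w x) * f x <= Normc.normc (h x)) ->
  K (fun x => mon w x * (f x)%:C%C).
Proof.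
move=> hL mf f0 fh.
have mfE : @measurable_fun _ _ (measurableTypeR R) _ setT (EFin \o f).
  exact/measurable_EFinP.
pose f_ := nnsfun_approx measurableT mfE.
have fE0 (x : measurableTypeR R) : setT x -> (0%R <= (EFin \o f) x)%E.
  by move=> _; rewrite lee_fin.
apply: (ker_mon_dominated (f_ := fun n => f_ n : R -> R) hL) => [n|n x x01|x x01].
- exact: ker_mon_nnsfun.
- apply: le_trans (fh x x01); rewrite ler_wpM2l ?normc_ge0//.
  rewrite ger0_norm ?fun_ge0// -lee_fin /f_ nnsfun_approxE.
  exact: (le_approx n fE0).
- have := cvg_nnsfun_approx measurableT mfE fE0 (I : setT (x : measurableTypeR R)).
  exact: fine_cvg.
Qed.

(** Since x^(w-1) has no zero on (0, 1], each h is x^(w-1) g there. The positive and negative parts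
    of Re g and Im g are at most |g|, so |h| dominates each of the four products. *)
Lemma ker_total (f : E) : X f = 0.
Proof.
have [h [hL ->]] := Lp_class_repr f.
have /(cLfun_integralP _ _ (ltW p1))[hr hi _] := hL.
pose w' := complex.Complex (2 - complex.Re w) (- complex.Im w).
have [mr mi] := measurable_mon w'.
pose g x := h x * mon w' x.
have gE x : 0 < x -> mon w x * g x = h x.
  by move=> x0; rewrite /g mulrCA mon_inv ?mulr1.
pose gr := (@complex.Re R \o g) \_ D.
pose gi := (@complex.Im R \o g) \_ D.
have mgr : measurable_fun setT gr.
  apply/(measurable_restrictT _ mD).
  rewrite (_ : _ \o _ = fun x => complex.Re (h x) * complex.Re (mon w' x) -
                                 complex.Im (h x) * complex.Im (mon w' x)).
    by apply: measurable_funB; apply: measurable_funM => //; exact: measurable_funTS.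
  by apply/funext => x; rewrite /g /=; case: (h x) (mon w' x) => [? ?] [? ?].
have mgi : measurable_fun setT gi.
  apply/(measurable_restrictT _ mD).
  rewrite (_ : _ \o _ = fun x => complex.Re (h x) * complex.Im (mon w' x) +
                                 complex.Im (h x) * complex.Re (mon w' x)).
    by apply: measurable_funD; apply: measurable_funM => //; exact: measurable_funTS.
  by apply/funext => x; rewrite /g /=; case: (h x) (mon w' x) => [? ?] [? ?].
have Dx x : 0 < x <= 1 -> D x by rewrite /= in_itv/= => /andP[/ltW -> ->].
have grE x : 0 < x <= 1 -> gr x = complex.Re (g x).
  by move=> /Dx xD; rewrite /gr patchE mem_set.
have giE x : 0 < x <= 1 -> gi x = complex.Im (g x).
  by move=> /Dx xD; rewrite /gi patchE mem_set.
have Kpart (u : R -> R) : measurable_fun setT u ->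
    (forall x, 0 < x <= 1 -> `|u x| <= Normc.normc (g x)) ->
    K (fun x => mon w x * (u x)%:C%C).
  move=> mu_ ug.
  have bound x (v : R) : 0 < x <= 1 -> v <= `|u x| ->
      Normc.normc (mon w x) * v <= Normc.normc (h x).
    move=> x01 vu; have /andP[x0 _] := x01; rewrite -(gE x x0) Normc.normcM.
    by rewrite ler_wpM2l ?normc_ge0//; apply: le_trans vu (ug x x01).
  have Kp := @ker_mon_ge0 (fun x => Num.max (u x) 0) h hL.
  have Kn := @ker_mon_ge0 (fun x => Num.max (- u x) 0) h hL.
  have {}Kp : K (fun x => mon w x * (Num.max (u x) 0)%:C%C).
    apply: Kp => [|x|x x01]; first exact: measurable_maxr.
      by rewrite le_max lexx orbT.
    by apply: bound => //; rewrite ge_max ler_norm normr_ge0.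
  have {}Kn : K (fun x => mon w x * (Num.max (- u x) 0)%:C%C).
    apply: Kn => [|x|x x01]; first by apply: measurable_maxr => //; exact: measurableT_comp.
      by rewrite le_max lexx orbT.
    by apply: bound => //; rewrite ge_max -normrN ler_norm normr_ge0.
  apply: ker_fun_eq (ker_fun_lin (-1) Kn Kp) => x _.
  rewrite -[LHS]/(-1 * (mon w x * (Num.max (- u x) 0)%:C%C) + mon w x * (Num.max (u x) 0)%:C%C).
  have e : u x = Num.max (u x) 0 - Num.max (- u x) 0.
    by rewrite /Order.max; case: ltP => u1; case: ltP => u2; lra.
  by rewrite [in RHS]e rmorphB/=; ring.
have Kr := Kpart gr mgr (fun x x01 =>
  eq_ind_r (fun y => `|y| <= _) (normc_ge_Re (g x)) (grE x x01)).
have Ki := Kpart gi mgi (fun x x01 =>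
  eq_ind_r (fun y => `|y| <= _) (normc_ge_Im (g x)) (giE x x01)).
have [kL Xk] := ker_fun_lin (complex.Complex 0 1) Ki Kr.
rewrite -Xk; congr (X _); apply/Lp_classP.
move: (ae_neq (0 : R)); apply: filterS; first exact: (ae_filter_ringOfSetsType mu).
move=> x xn0 xD; have x01 : 0 < x <= 1.
  by move: xD; rewrite /= in_itv/= lt_neqAle eq_sym xn0.
have /andP[x0 _] := x01.
rewrite -[RHS]/(complex.Complex 0 1 * (mon w x * (gi x)%:C%C) + mon w x * (gr x)%:C%C).
rewrite grE// giE// -[LHS](gE x x0); case: (g x) (mon w x) => [a b] [c e] /=.
by congr complex.Complex; ring.
Qed.

End density.
End extended_eigenvalues.

(** With nu = 1/lambda, the half-planes Re w > s and Re (w nu) < s meet: far out in an imaginary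
    direction if nu is not real, and next to w = s if nu is real and below 1. Being open, their
    intersection contains a horizontal segment. *)
Lemma half_plane_segment {R : realType} (s : R) (nu : R[i]) : 0 < s ->
  complex.Im nu != 0 \/ complex.Re nu < 1 ->
  exists (w : R[i]) (d : R), [/\ s < complex.Re w, 0 < d &
    forall t, 0 <= t <= d -> complex.Re ((w + t%:C%C) * nu) < s].
Proof.
move=> s0; case: nu => a b /=; have [->|b0] := eqVneq b 0.
  (* The real part is at most s a + 2 e |a|, and 4 e (|a| + 1) = s (1 - a) keeps it below s. The
     summand 1 covers a = 0. *)
  case=> // a1; pose e := s * (1 - a) / (4 * (`|a| + 1)).
  have e0 : 0 < e by rewrite divr_gt0 ?mulr_gt0 ?subr_gt0 ?ltr_wpDl.
  exists (complex.Complex (s + e) 0), e; split => //=; first by rewrite ltrDl.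
  move=> t /andP[t0 te]; rewrite mulr0 subr0.
  have eE : 4 * e * (`|a| + 1) = s * (1 - a).
    by rewrite /e; field; rewrite gt_eqF// ltr_wpDl.
  have h : (e + t) * a <= 2 * e * `|a|.
    apply: le_trans (_ : (e + t) * `|a| <= _).
      by rewrite ler_wpM2l ?ler_norm// addr_ge0// ltW.
    by rewrite ler_wpM2r//; lra.
  by have := mulr_gt0 s0 (_ : 0 < 1 - a); rewrite subr_gt0 a1 => /(_ isT); nra.
(* This imaginary part makes the real part (s + 1 + t) a - (s + 2) |a|, which is nonpositive for t
   <= 1. *)
move=> _; exists (complex.Complex (s + 1) ((s + 2) * `|a| / b)), 1.
split => //=; first by rewrite ltrDl.
move=> t /andP[t0 t1]; rewrite addr0 divfK//.
have : (s + 1 + t) * a <= (s + 2) * `|a|.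
  apply: le_trans (_ : (s + 1 + t) * `|a| <= _).
    by rewrite ler_wpM2l ?ler_norm// !addr_ge0// ltW.
  by rewrite ler_wpM2r//; lra.
lra.
Qed.

Theorem corollary4p5 (R : realType) (p : R) (p1 : 1 < p) (lambda : R[i]) :
  extended_eigenvalue (cesaro_op p1) lambda ->
  complex.Im lambda = 0 /\ 0 < complex.Re lambda <= 1.
Proof.
move=> [X [bX [f Xf] TX]].
have s0 : 0 < 1 - p^-1 by rewrite subr_gt0 invf_lt1// (lt_trans ltr01).
have l0 : lambda != 0.
  apply: contra Xf => /eqP l0; have := TX f; rewrite l0 scale0r.
  have [h [hL ->]] := Lp_class_repr (X f).
  rewrite (cesaro_op_class p1 hL) => /Lp_class_eq0 /(cesaro_fun_eq0 p1 hL) h0.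
  by apply/eqP/Lp_class_eq0.
(* A nonnegative shift only increases Re w, so every point w + t of the segment meets both
   conditions of [ker_mon]; [ker_total] then gives X = 0. *)
have no_segment w (d : R) : 1 - p^-1 < complex.Re w -> 0 < d ->
    ~ forall t, 0 <= t <= d -> complex.Re ((w + t%:C%C) / lambda) < 1 - p^-1.
  move=> sw d0 wd; move/eqP : Xf; apply; apply: (ker_total bX sw).
  exists d => // t /[dup] td /andP[t0 _].
  apply: ker_mon l0 TX _ (wd t td).
  by rewrite raddfD/= (lt_le_trans sw)// lerDl.
have := half_plane_segment (nu := lambda^-1) s0.
case: (eqVneq (complex.Im lambda^-1) 0) => [im0|im0]; last first.
  by case=> [|w [d [sw d0 wd]]]; [left|case: (no_segment w d sw d0)].
have [re1|re1] := ltP (complex.Re lambda^-1) 1.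
  by case=> [|w [d [sw d0 wd]]]; [right|case: (no_segment w d sw d0)].
move=> _; have nuE : lambda^-1 = (complex.Re lambda^-1)%:C%C.
  by move: im0; case: (lambda^-1) => a b /= ->.
have -> : lambda = ((complex.Re lambda^-1)^-1)%:C%C.
  by rewrite fmorphV/= -nuE invrK.
have re0 := lt_le_trans ltr01 re1.
by split; rewrite //= invr_gt0 re0/= invf_le1.
Qed.
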